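(* Let $n \geqslant 4$ and let $G = S_n$ be a transitive permutation group (acting faithfully) on a finite set $\Omega$ with point stabiliser $H$. (i) We have $G = \Delta(G)^2$. (ii) Moreover, if $\Omega \ne \{1, \ldots, n\}$ (that is, the action is not the natural action of $S_n$ on $\{1,\ldots,n\}$), then there exist conjugacy classes $C$ and $D$ of derangements such that $G = C^2 \cup CD$.
   Context: An element of $G$ is a derangement if it has no fixed points on $\Omega$; $\Delta(G)$ is the set of derangements in $G$. For subsets $A,B$ of $G$, $AB=\{ab: a\in A,b\in B\}$ and $A^2 = AA$. *)

(* Defs.v *)
From mathcomp Require Export all_boot all_fingroup.

Set Implicit Arguments.
Unset Strict Implicit.
Unset Printing Implicit Defensive.

Local Open Scope group_scope.

Section Derangements.

Variables (aT : finGroupType) (T : finType) (to : {action aT &-> T}).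

Definition derangements (G : {set aT}) : {set aT} :=
  [set g in G | 'Fix_to[g] == set0].

Definition derangement_class (G C : {set aT}) : Prop :=
  C \in classes G /\ C \subset derangements G.

(* Equivalence over the identity of aT, not merely permutation isomorphism:
   the action of 'S_6 on 6 points twisted by an outer automorphism is not
   equivalent to the natural one. *)
Definition equivalent_actions (S : finType) (toS : {action aT &-> S}) : Prop :=
  exists2 f : S -> T, bijective f & morph_act toS to f id.

End Derangements.

(* The natural action of 'S_n on n points is 'P, on the index type 'I_n. *)
Definition is_natural_action (n : nat) (T : finType)
    (to : {action 'S_n &-> T}) : Prop :=
  equivalent_actions to ('P : {action 'S_n &-> 'I_n}).

(* Main.v *)
(* Both claims follow once we know, for every core-free H <= S_n, two cycle
   types such that no element of H has one of them and such that the
   corresponding classes C and D satisfy: C^2 contains all even permutations and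
   CD all odd ones.

   Covering.  To write E = c d^-1, start from a permutation d with short cycles
   that link the cycles of E, so that E d is, up to a few explicit short cycles,
   one large cycle L.  If x, y, z lie on L and on three different cycles of d,
   then multiplying by (x y z) or by its inverse merges these three cycles of d,
   while the support of L still carries a single cycle of E d.  Repeating this
   brings d to the required type.  The types obtained for (C, D) are (n), (n-1,1);
   (n), (n-2,2); (n-1,1), (n-2,1,1); (n-2,2), (n-4,2,2) for n odd; and
   (n-3,2,1), (n-5,2,2,1) for n even, except that D has type (3,1,1), (3,1,1,1)
   and (4,3,2) for n = 5, 6 and 9 respectively in the last two families.

   Choice.  If none of the first three pairs avoids H, then H is transitive, and
   either 2-transitive or with blocks of size 2.  A core-free 2-transitive group
   contains no transposition, no 3-cycle and, for n >= 10, no product of two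
   disjoint transpositions, but elements of the remaining types have powers of
   these forms.  Blocks of size 2 force n to be even and are incompatible with an
   element having exactly one fixed point. *)

From mathcomp Require Import zify all_solvable.
Require Import Defs.

Set Implicit Arguments.
Unset Strict Implicit.
Unset Printing Implicit Defensive.

(** * Cycles given by sequences *)

Section CyclesOfSequences.

Variable T : eqType.
Implicit Types (x y u v : T) (c l m : seq T) (cs ds : seq (seq T)).

(* The permutation with the pairwise disjoint cycles cs. *)
Definition cyc cs x := foldr (@next T) x cs.

Definition swap x y u := if u == x then y else if u == y then x else u.

Lemma next_notin c u : u \notin c -> next c u = u.
Proof. by rewrite next_nth => /negbTE ->. Qed.

Lemma next_at_notin u x y l : u \notin y :: l -> next_at u x y l = u.
Proof.
elim: l y => [|z l IH] y /=; first by rewrite inE => /negbTE ->.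
by rewrite inE negb_or => /andP[/negbTE -> /IH].
Qed.

Lemma next_at_cat u x y z l1 l2 :
  next_at u x y (l1 ++ z :: l2) =
  if u \in y :: l1 then next_at u z y l1 else next_at u x z l2.
Proof.
elim: l1 y => [|w l1 IH] y /=; first by rewrite inE; case: eqP.
by rewrite inE; case: eqP => //= _; rewrite IH.
Qed.

Lemma next_at_swap u x y z l :
  u \in z :: l -> x \notin l -> y \notin l ->
  swap x y (next_at u x z l) = next_at u y z l.
Proof.
elim: l z => [|w l IH] z /=.
  by rewrite inE => /eqP ->; rewrite eqxx /swap eqxx.
rewrite [u \in _]inE [x \in _]inE [y \in _]inE.
case: eqP => [_ _|_ /= ul]; rewrite !negb_or => /andP[xw xl] /andP[yw yl].
  by rewrite /swap eq_sym (negbTE xw) eq_sym (negbTE yw).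
exact: IH.
Qed.

Lemma swapC x y u : swap x y u = swap y x u.
Proof. by rewrite /swap; case: eqP => [->|]; case: eqP. Qed.

Lemma swapK x y : involutive (swap x y).
Proof.
move=> u; rewrite /swap; case: (u =P x) => [->|ux].
  by case: (y =P x) => // _; rewrite eqxx.
by case: (u =P y) => [->|uy]; rewrite ?eqxx //; do 2 case: eqP => //.
Qed.

(** Multiplying by a transposition merges two disjoint cycles: the arcs returning to [x] and to [y]
    are exchanged. Every merging below rests on this identity. *)
Lemma next_cat x y l1 l2 u : uniq ((x :: l1) ++ y :: l2) ->
  next ((x :: l1) ++ y :: l2) u =
  swap x y (next (x :: l1) (next (y :: l2) u)).
Proof.
rewrite cat_uniq => /and3P[u1 /hasPn dis u2].
have {}dis v : v \in x :: l1 -> v \notin y :: l2.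
  by move=> v1; apply: contraL v1; apply: dis.
have xl1 : x \notin l1 by case/andP: u1.
have yl2 : y \notin l2 by case/andP: u2.
have yl1 : y \notin l1.
  by apply/negP => h; have := dis y; rewrite inE h orbT mem_head => /(_ isT).
have xl2 : x \notin l2.
  by have := dis x; rewrite mem_head inE negb_or => /(_ isT) /andP[].
rewrite [LHS]/= next_at_cat; case: ifP => [u1' | /negbT u1'].
  by rewrite (next_notin (dis u u1')) /= next_at_swap.
case: (boolP (u \in y :: l2)) => [u2' | u2'].
  rewrite (@next_notin (x :: l1)); last first.
    by apply/negP => /dis; rewrite mem_next u2'.
  by rewrite swapC /= next_at_swap.
rewrite next_at_notin // (next_notin u2') next_notin // /swap.
by move: u1' u2'; rewrite !inE !negb_or => /andP[/negbTE -> _] /andP[/negbTE -> _].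
Qed.

Lemma cyc_cons c cs x : cyc (c :: cs) x = next c (cyc cs x).
Proof. by []. Qed.

Lemma cyc_cat cs ds x : cyc (cs ++ ds) x = cyc cs (cyc ds x).
Proof. by rewrite /cyc foldr_cat. Qed.

Lemma cyc_notin cs x : x \notin flatten cs -> cyc cs x = x.
Proof.
elim: cs => //= c cs IH; rewrite mem_cat negb_or => /andP[xc /IH ->].
exact: next_notin.
Qed.

Lemma mem_cyc cs x : (cyc cs x \in flatten cs) = (x \in flatten cs).
Proof.
elim: cs x => //= c cs IH x; rewrite !mem_cat mem_next.
case: (boolP (x \in flatten cs)) => [xcs | xcs]; last first.
  rewrite cyc_notin // orbF; case: (boolP (x \in c)) => //= xc.
  by rewrite next_notin // (negbTE xcs).
rewrite orbT; case: (boolP (cyc cs x \in c)) => //= nc.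
by rewrite next_notin // IH.
Qed.

Lemma cyc_in cs c x : uniq (flatten cs) -> c \in cs -> x \in c ->
  cyc cs x = next c x.
Proof.
elim: cs => //= c0 cs IH; rewrite cat_uniq => /and3P[u0 /hasPn dis us].
rewrite inE => /predU1P[-> | ccs] xc.
  by rewrite cyc_notin //; apply/negP => /dis; rewrite /= xc.
rewrite IH // next_notin //; apply: dis.
by apply/flattenP; exists c => //; rewrite mem_next.
Qed.

Lemma eq_cyc cs ds : perm_eq cs ds -> uniq (flatten cs) -> cyc cs =1 cyc ds.
Proof.
move=> pcd ucs x; have pf := perm_flatten pcd.
have uds : uniq (flatten ds) by rewrite -(perm_uniq pf).
case: (boolP (x \in flatten cs)) => [/flattenP[c ccs xc] | nx].
  by rewrite (cyc_in ucs ccs xc) (cyc_in (c := c)) // -(perm_mem pcd).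
by rewrite !cyc_notin // -(perm_mem pf).
Qed.

Lemma cyc_rev cs : uniq (flatten cs) -> cancel (cyc cs) (cyc (map rev cs)).
Proof.
move=> ucs x.
have pf : perm_eq (flatten (map rev cs)) (flatten cs).
  elim: cs {ucs} => //= c cs IH; rewrite perm_cat //.
  by rewrite perm_rev.
case: (boolP (x \in flatten cs)) => [/flattenP[c ccs xc] | nx].
  have uc : uniq c.
    elim: cs ucs ccs {pf} => //= c0 cs IH; rewrite cat_uniq => /and3P[u0 _ us].
    by rewrite inE => /predU1P[-> | /IH ->].
  rewrite (cyc_in ucs ccs xc) (cyc_in (c := rev c)) ?map_f ?(perm_uniq pf) //.
    by rewrite next_rev // prev_next.
  by rewrite mem_rev mem_next.
by rewrite !cyc_notin // (perm_mem pf).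
Qed.

Lemma next_rot_to c x : uniq c -> x \in c ->
  {l | perm_eq c (x :: l) & next c =1 next (x :: l)}.
Proof.
move=> uc /rot_to[i l e]; exists l; first by rewrite -e perm_sym perm_rot.
by move=> u; rewrite -e next_rot.
Qed.

End CyclesOfSequences.

Lemma cyc_map (T S : eqType) (h : T -> S) cs x :
  injective h -> uniq (flatten cs) ->
  cyc (map (map h) cs) (h x) = h (cyc cs x).
Proof.
move=> hi; elim: cs => //= c cs IH; rewrite cat_uniq => /and3P[uc _ /IH ->].
by rewrite next_map.
Qed.

(** * Factorizations *)

Section Factorizations.

Variable T : eqType.
Implicit Types (d L : seq T) (es ds cs : seq (seq T)).

(* E d = c on cycle lists; permutations are composed from left to right. *)
Definition fac es ds cs :=
  [/\ uniq (flatten es), perm_eq (flatten ds) (flatten es),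
      perm_eq (flatten cs) (flatten es)
    & forall u, cyc ds (cyc es u) = cyc cs u].

Lemma flatten_cons d ds : flatten (d :: ds) = d ++ flatten ds.
Proof. by []. Qed.

(** [cyc] does not see cycles of length 1, so the supports are compared as well. *)
Definition eqc cs cs' :=
  perm_eq (flatten cs') (flatten cs) /\ cyc cs' =1 cyc cs.

Lemma fac_eq es ds cs es' ds' cs' :
  fac es ds cs -> eqc es es' -> eqc ds ds' -> eqc cs cs' -> fac es' ds' cs'.
Proof.
move=> [ue pd pc e] [pe' ee'] [pd' ed'] [pc' ec']; split.
- by rewrite (perm_uniq pe').
- by rewrite (perm_trans pd') // (perm_trans pd) // perm_sym.
- by rewrite (perm_trans pc') // (perm_trans pc) // perm_sym.
by move=> u; rewrite ee' ed' ec'.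
Qed.

Lemma eqc_perm cs cs' : uniq (flatten cs) -> perm_eq cs cs' -> eqc cs cs'.
Proof.
move=> u p; split; first by rewrite perm_sym; apply: perm_flatten.
by move=> x; rewrite (eq_cyc p).
Qed.

Lemma fac_perm es ds cs es' ds' cs' : fac es ds cs ->
  perm_eq es es' -> perm_eq ds ds' -> perm_eq cs cs' -> fac es' ds' cs'.
Proof.
move=> f pe pd pc; case: (f) => ue pd0 pc0 _.
apply: (fac_eq f); apply: eqc_perm => //.
  by rewrite (perm_uniq pd0).
by rewrite (perm_uniq pc0).
Qed.

Lemma fac_union es1 ds1 cs1 es2 ds2 cs2 :
  fac es1 ds1 cs1 -> fac es2 ds2 cs2 ->
  ~~ has (mem (flatten es1)) (flatten es2) ->
  fac (es1 ++ es2) (ds1 ++ ds2) (cs1 ++ cs2).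
Proof.
move=> [u1 pd1 pc1 e1] [u2 pd2 pc2 e2] dis; split.
- by rewrite flatten_cat cat_uniq u1 u2 dis.
- by rewrite !flatten_cat perm_cat.
- by rewrite !flatten_cat perm_cat.
have {}dis v : v \in flatten es2 -> v \notin flatten es1.
  by move=> h; apply: (hasPn dis).
move=> u; rewrite !cyc_cat.
case: (boolP (u \in flatten es2)) => u2'.
  have h : cyc es2 u \in flatten es2 by rewrite mem_cyc.
  have h2 : cyc cs2 u \notin flatten es1.
    by rewrite dis // -(perm_mem pc2) mem_cyc (perm_mem pc2).
  rewrite (@cyc_notin _ es1) ?dis // e2 (@cyc_notin _ cs1) ?(perm_mem pc1) //.
  by rewrite cyc_notin // (perm_mem pd1).
rewrite (@cyc_notin _ es2) // (@cyc_notin _ cs2) ?(perm_mem pc2) //.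
rewrite (@cyc_notin _ ds2) ?e1 // (perm_mem pd2).
case: (boolP (u \in flatten es1)) => u1'; last by rewrite cyc_notin.
by apply: (contraL (@dis _)); rewrite mem_cyc.
Qed.

(** Inverting [E d = c] gives [d^-1 E^-1 = c^-1], which exchanges the roles of [E] and [d] and keeps
    all cycle lengths. *)
Lemma fac_rev es ds cs : fac es ds cs ->
  fac (map rev ds) (map rev es) (map rev cs).
Proof.
have pf (l : seq (seq T)) : perm_eq (flatten (map rev l)) (flatten l).
  by elim: l => //= c l IH; rewrite perm_cat // perm_rev.
have rr (l : seq (seq T)) : map rev (map rev l) = l.
  by rewrite -map_comp -[RHS]map_id; apply: eq_map => s; rewrite /= revK.
move=> [ue pd pc e].
have ud : uniq (flatten ds) by rewrite (perm_uniq pd).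
have uc : uniq (flatten cs) by rewrite (perm_uniq pc).
split.
- by rewrite (perm_uniq (pf _)).
- by rewrite (perm_trans (pf _)) // perm_sym (perm_trans (pf _)).
- rewrite (perm_trans (pf _)) // perm_sym (perm_trans (pf _)) //.
  by rewrite (perm_trans pd) // perm_sym.
move=> u; set v := cyc (map rev es) _.
have K (l : seq (seq T)) : uniq (flatten l) -> cancel (cyc (map rev l)) (cyc l).
  move=> ul; have := @cyc_rev T (map rev l).
  by rewrite rr; apply; rewrite (perm_uniq (pf _)).
have -> : u = cyc cs v by rewrite -e !K.
by rewrite cyc_rev.
Qed.

(** Take [x] on [d1] and [L1], [y] on [d2] and [L2], and multiply both sides of [E d = c] on the
    right by [(x y)]: both pairs of cycles merge and [E] is unchanged. *)
Lemma fac_merge es d1 d2 ds L1 L2 cs :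
  fac es (d1 :: d2 :: ds) (L1 :: L2 :: cs) ->
  has (mem L1) d1 -> has (mem L2) d2 ->
  exists d L, [/\ perm_eq d (d1 ++ d2), perm_eq L (L1 ++ L2)
                & fac es (d :: ds) (L :: cs)].
Proof.
move=> f /hasP[x xd1 xL1] /hasP[y yd2 yL2].
have [ue pd pc e] := f.
have [ud uc] : uniq (d1 ++ d2 ++ flatten ds) /\ uniq (L1 ++ L2 ++ flatten cs).
  by rewrite (perm_uniq pd) (perm_uniq pc).
have : uniq (d1 ++ d2) by move: ud; rewrite catA cat_uniq; case/andP.
have : uniq (L1 ++ L2) by move: uc; rewrite catA cat_uniq; case/andP.
move=> uL12 ud12.
have [ud1 ud2] : uniq d1 /\ uniq d2.
  by move: ud12; rewrite cat_uniq => /and3P[].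
have [uL1 uL2] : uniq L1 /\ uniq L2.
  by move: uL12; rewrite cat_uniq => /and3P[].
have [m1 pm1 em1] := next_rot_to ud1 xd1.
have [m2 pm2 em2] := next_rot_to ud2 yd2.
have [l1 pl1 el1] := next_rot_to uL1 xL1.
have [l2 pl2 el2] := next_rot_to uL2 yL2.
have pm : perm_eq ((x :: m1) ++ y :: m2) (d1 ++ d2).
  by rewrite perm_sym perm_cat.
have pl : perm_eq ((x :: l1) ++ y :: l2) (L1 ++ L2).
  by rewrite perm_sym perm_cat.
exists ((x :: m1) ++ y :: m2), ((x :: l1) ++ y :: l2); split=> //; split=> //.
- by apply: perm_trans pd; rewrite !flatten_cons catA perm_cat2r.
- by apply: perm_trans pc; rewrite !flatten_cons catA perm_cat2r.
move=> u; have := e u; rewrite !cyc_cons em1 em2 el1 el2 => E.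
rewrite !next_cat ?(perm_uniq pm) ?(perm_uniq pl) //.
by congr (swap _ _ _).
Qed.

(** Both sides are multiplied by [(x y)], then by [(x z)]. Each step merges two cycles of [d]. On
    the long cycle the first step splits off [x l1] from [y l2 z l3], and the second glues the
    pieces back in the order [x l1 z l3 y l2]. *)
Lemma fac_merge3_ord es d1 d2 d3 ds x l1 y l2 z l3 cs :
  fac es (d1 :: d2 :: d3 :: ds)
    (((x :: l1) ++ (y :: l2) ++ z :: l3) :: cs) ->
  x \in d1 -> y \in d2 -> z \in d3 ->
  exists d L, [/\ perm_eq d (d1 ++ d2 ++ d3),
                  perm_eq L ((x :: l1) ++ (y :: l2) ++ z :: l3)
                & fac es (d :: ds) (L :: cs)].
Proof.
move=> f xd1 yd2 zd3; have [ue pd pc e] := f.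
have ud : uniq (d1 ++ d2 ++ d3 ++ flatten ds) by rewrite (perm_uniq pd).
have : uniq (d1 ++ d2 ++ d3).
  by move: ud; rewrite !catA cat_uniq -!catA; case/andP.
have uL : uniq ((x :: l1) ++ (y :: l2) ++ z :: l3).
  have : uniq (((x :: l1) ++ (y :: l2) ++ z :: l3) ++ flatten cs).
    by rewrite (perm_uniq pc).
  by rewrite cat_uniq; case/andP.
move=> ud123.
have [ud1 ud2 ud3] : [/\ uniq d1, uniq d2 & uniq d3].
  by move: ud123; rewrite !cat_uniq => /and3P[-> _ /and3P[-> _ ->]].
have [m1 pm1 em1] := next_rot_to ud1 xd1.
have [m2 pm2 em2] := next_rot_to ud2 yd2.
have [m3 pm3 em3] := next_rot_to ud3 zd3.
have pm : perm_eq (((x :: m1) ++ y :: m2) ++ z :: m3) (d1 ++ d2 ++ d3).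
  by rewrite -catA perm_sym perm_cat // perm_cat.
have pl : perm_eq ((x :: l1) ++ (z :: l3) ++ y :: l2)
                  ((x :: l1) ++ (y :: l2) ++ z :: l3).
  by rewrite perm_cat2l perm_catC.
have um : uniq (((x :: m1) ++ y :: m2) ++ z :: m3) by rewrite (perm_uniq pm).
have um12 : uniq ((x :: m1) ++ y :: m2).
  by move: um; rewrite cat_uniq; case/andP.
have ul : uniq ((x :: l1) ++ (z :: l3) ++ y :: l2) by rewrite (perm_uniq pl).
exists (((x :: m1) ++ y :: m2) ++ z :: m3), ((x :: l1) ++ (z :: l3) ++ y :: l2).
split=> //; split=> //.
- by apply: perm_trans pd; rewrite !flatten_cons !catA perm_cat2r -(catA d1).
- by apply: perm_trans pc; rewrite !flatten_cons perm_cat2r.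
move=> u; have := e u; rewrite !cyc_cons em1 em2 em3 => E.
rewrite (next_cat (l1 := m1 ++ y :: m2) _ um) (next_cat _ um12) E.
rewrite (next_cat (l2 := l2 ++ z :: l3) _ uL) swapK.
rewrite (next_cat (l2 := l3 ++ y :: l2) _ ul); congr (swap _ _ (next _ _)).
rewrite -(@next_rot (size (y :: l2)) _ ((y :: l2) ++ z :: l3)) ?rot_size_cat //.
by move: uL; rewrite cat_uniq => /and3P[].
Qed.

Lemma fac_merge3 es d1 d2 d3 ds L cs :
  fac es (d1 :: d2 :: d3 :: ds) (L :: cs) ->
  has (mem L) d1 -> has (mem L) d2 -> has (mem L) d3 ->
  exists d L', [/\ perm_eq d (d1 ++ d2 ++ d3), perm_eq L' L
                & fac es (d :: ds) (L' :: cs)].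
Proof.
move=> f /hasP[x xd1 xL] /hasP[y yd2 yL] /hasP[z zd3 zL].
have [ue pd pc e] := f.
have ud : uniq (d1 ++ d2 ++ d3 ++ flatten ds) by rewrite (perm_uniq pd).
have uL : uniq L.
  have : uniq (L ++ flatten cs) by rewrite (perm_uniq pc).
  by rewrite cat_uniq; case/andP.
have [l pl el] := next_rot_to uL xL.
have [xy xz yz] : [/\ y != x, z != x & z != y].
  split; apply/eqP => E; move: ud; subst; rewrite !cat_uniq !has_cat.
  - by case/and3P=> _; rewrite negb_or => /andP[/hasPn/(_ _ yd2)]; rewrite /= xd1.
  - case/and3P=> _; rewrite !negb_or => /and3P[_ /hasPn/(_ _ zd3)].
    by rewrite /= xd1.
  - case/and5P=> _ _ _; rewrite !negb_or => /andP[/hasPn/(_ _ zd3)].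
    by rewrite /= yd2.
have fx : fac es (d1 :: d2 :: d3 :: ds) ((x :: l) :: cs).
  apply: (fac_eq f); rewrite /eqc //; split; first by rewrite !flatten_cons perm_cat2r perm_sym.
  by move=> u; rewrite !cyc_cons el.
have yl : y \in l by have := yL; rewrite /= (perm_mem pl) inE (negbTE xy).
have zl : z \in l by have := zL; rewrite /= (perm_mem pl) inE (negbTE xz).
case/splitPr: yl pl fx zl => p q pl fx.
rewrite mem_cat inE (negbTE yz) /= => /orP[zp|zq].
  (* Here [z] precedes [y] on [L]; exchanging [d2] and [d3] restores the required cyclic order. *)
  case/splitPr: zp pl fx => p1 p2 pl fx.
  have fx' : fac es (d1 :: d3 :: d2 :: ds)
      (((x :: p1) ++ (z :: p2) ++ y :: q) :: cs).
    move: fx; rewrite -catA => fx; apply: (fac_perm fx) => //.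
    by rewrite perm_cons; apply: (permEl (perm_catCA [:: d2] [:: d3] ds)).
  have [d [L' [pd' pL' f']]] := fac_merge3_ord fx' xd1 zd3 yd2.
  exists d, L'; split=> //.
    by rewrite (perm_trans pd') // perm_cat2l perm_catC.
  by rewrite (perm_trans pL') // perm_sym (perm_trans pl) // -catA.
case/splitPr: zq pl fx => q1 q2 pl fx.
have [d [L' [pd' pL' f']]] := fac_merge3_ord (l1 := p) (l2 := q1) fx xd1 yd2 zd3.
exists d, L'; split=> //.
by rewrite (perm_trans pL') // perm_sym.
Qed.

End Factorizations.

Lemma fac_map (T S : eqType) (h : T -> S) es ds cs : injective h ->
  fac es ds cs ->
  fac (map (map h) es) (map (map h) ds) (map (map h) cs).
Proof.
move=> hi [ue pd pc e]; split; rewrite -?map_flatten ?map_inj_uniq ?perm_map //.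
move=> u; case: (boolP (u \in map h (flatten es))) => [/mapP[v _ ->]|nu].
  by rewrite !cyc_map ?e ?(perm_uniq pd) ?(perm_uniq pc).
rewrite (@cyc_notin _ _ u); last by rewrite -map_flatten.
rewrite !cyc_notin // -map_flatten; first by rewrite (perm_mem (perm_map h pc)).
by rewrite (perm_mem (perm_map h pd)).
Qed.

Lemma shape_cons (T : eqType) (ds : seq (seq T)) a m :
  perm_eq (shape ds) (a :: m) ->
  exists d ds', [/\ perm_eq ds (d :: ds'), size d = a & perm_eq (shape ds') m].
Proof.
move=> p; have : a \in shape ds by rewrite (perm_mem p) mem_head.
case/mapP=> d dds ea; subst a; exists d, (rem d ds).
have pr := perm_to_rem dds.
split=> //; rewrite -(perm_cons (size d)); apply: perm_trans p.
by rewrite perm_sym; apply: (perm_map size pr).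
Qed.

(* Factorizations E d = c on arbitrary labels, by cycle types: l is the type of E,
   m that of d, and N :: nu that of c.  Every cycle of E and of d meets the cycle
   L of c of length N: this is what makes the mergings below possible. *)
Definition Linked (l m : seq nat) (N : nat) (nu : seq nat) :=
  exists es ds cs : seq (seq nat), exists L : seq nat,
  [/\ fac es ds (L :: cs),
      all (has (mem L)) es /\ all (has (mem L)) ds,
      perm_eq (shape es) l, perm_eq (shape ds) m
    & size L = N /\ perm_eq (shape cs) nu].

Lemma Linked_perm l m N nu l' m' nu' : Linked l m N nu ->
  perm_eq l l' -> perm_eq m m' -> perm_eq nu nu' -> Linked l' m' N nu'.
Proof.
move=> [es [ds [cs [L [f me pe pd [sL pc]]]]]] pl pm pn.
exists es, ds, cs, L; split=> //; first exact: perm_trans pl.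
  exact: perm_trans pm.
by split=> //; apply: perm_trans pn.
Qed.

Lemma Linked_sym l m N nu : Linked l m N nu -> Linked m l N nu.
Proof.
have sr (s : seq (seq nat)) : shape (map rev s) = shape s.
  by rewrite /shape -map_comp; apply: eq_map => x; rewrite /= size_rev.
have hr L (s : seq (seq nat)) :
    all (has (mem L)) s -> all (has (mem (rev L))) (map rev s).
  rewrite all_map; apply: sub_all => x /hasP[y yx yL].
  by apply/hasP; exists y; rewrite /= mem_rev.
move=> [es [ds [cs [L [f [me md] pe pd [sL pc]]]]]].
exists (map rev ds), (map rev es), (map rev cs), (rev L).
by split; rewrite ?sr ?size_rev //; [exact: (fac_rev f) | split; exact: hr].
Qed.

Lemma disjoint_relabelling (s : seq nat) (es : seq (seq nat)) :
  exists2 h : nat -> nat, injective h &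
  ~~ has (mem s) (flatten (map (map h) es)).
Proof.
pose k := (\max_(i <- s) i).+1.
exists (addn k); first exact: addnI.
rewrite -map_flatten; apply/hasPn => _ /mapP[x _ ->]; apply/negP => /= xs.
have := @leq_bigmax_seq _ s xpredT id _ xs isT.
by rewrite -ltnS -/k; lia.
Qed.

(** Put the two factorizations on disjoint labels, then merge one cycle of each [d] together with
    the two long cycles. The new [L] contains both old ones, so linking persists; the cycles of [E]
    are merely juxtaposed. *)
Lemma Linked_join a1 a2 l1 l2 m1 m2 N1 N2 nu1 nu2 :
  Linked l1 (a1 :: m1) N1 nu1 -> Linked l2 (a2 :: m2) N2 nu2 ->
  Linked (l1 ++ l2) ((a1 + a2) :: m1 ++ m2) (N1 + N2) (nu1 ++ nu2).
Proof.
move=> [es1 [ds1 [cs1 [L1 [f1 [me1 md1] pe1 pd1 [sL1 pc1]]]]]].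
move=> [es2 [ds2 [cs2 [L2 [f2 [me2 md2] pe2 pd2 [sL2 pc2]]]]]].
have [d1 [ds1' [q1 sd1 pd1']]] := shape_cons pd1.
have [d2 [ds2' [q2 sd2 pd2']]] := shape_cons pd2.
have {f1} f1 := fac_perm f1 (perm_refl _) q1 (perm_refl _).
have {f2} f2 := fac_perm f2 (perm_refl _) q2 (perm_refl _).
have [h hi dis] := disjoint_relabelling (flatten es1) es2.
have {}f2 := fac_map hi f2.
have := fac_union f1 f2 dis; rewrite /= => f.
have {}f : fac (es1 ++ map (map h) es2)
    (d1 :: map h d2 :: ds1' ++ map (map h) ds2')
    (L1 :: map h L2 :: cs1 ++ map (map h) cs2).
  apply: (fac_perm f) => //; rewrite perm_cons.
    exact: (permEl (perm_catCA ds1' [:: map h d2] _)).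
  exact: (permEl (perm_catCA cs1 [:: map h L2] _)).
have hasm (L : seq nat) s : has (mem (map h L)) (map h s) = has (mem L) s.
  by rewrite has_map; apply: eq_has => x; rewrite /= mem_map.
have hd1 : has (mem L1) d1.
  by apply: (allP md1); rewrite (perm_mem q1) mem_head.
have hd2 : has (mem (map h L2)) (map h d2).
  by rewrite hasm; apply: (allP md2); rewrite (perm_mem q2) mem_head.
have [d [L [pd pL f']]] := fac_merge f hd1 hd2.
have L1L s : has (mem L1) s -> has (mem L) s.
  by apply: sub_has => x; rewrite /= (perm_mem pL) mem_cat => ->.
have L2L s : has (mem L2) s -> has (mem L) (map h s).
  rewrite -hasm; apply: sub_has => x.
  by rewrite /= (perm_mem pL) mem_cat orbC => ->.
have shm (s : seq (seq nat)) : shape (map (map h) s) = shape s.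
  by rewrite /shape -map_comp; apply: eq_map => x; rewrite /= size_map.
exists (es1 ++ map (map h) es2), (d :: ds1' ++ map (map h) ds2').
exists (cs1 ++ map (map h) cs2), L; split=> //.
- have md1' : all (has (mem L)) (d1 :: ds1').
    by rewrite -(perm_all _ q1); apply: sub_all md1.
  have md2' : all (has (mem L)) (map (map h) ds2').
    rewrite all_map; move: md2; rewrite (perm_all _ q2) => /andP[_].
    exact: sub_all.
  split; first by rewrite all_cat all_map (sub_all L1L me1) (sub_all L2L me2).
  have /=/andP[/hasP[x xd1 xL] md1''] := md1'.
  rewrite /= all_cat md1'' md2' !andbT; apply/hasP; exists x => //.
  by rewrite (perm_mem pd) mem_cat xd1.
- by rewrite /shape map_cat perm_cat // -/(shape _) shm.
- rewrite /shape /= (perm_size pd) size_cat size_map sd1 sd2 perm_cons.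
  by rewrite map_cat perm_cat // -/(shape _) shm.
rewrite (perm_size pL) size_cat size_map sL1 sL2; split=> //.
by rewrite /shape map_cat perm_cat // -/(shape _) shm.
Qed.

Lemma Linked_join_left a1 a2 l1 l2 m1 m2 N1 N2 nu1 nu2 :
  Linked (a1 :: l1) m1 N1 nu1 -> Linked (a2 :: l2) m2 N2 nu2 ->
  Linked ((a1 + a2) :: l1 ++ l2) (m1 ++ m2) (N1 + N2) (nu1 ++ nu2).
Proof.
move=> g1 g2; apply: Linked_sym.
by apply: Linked_join; apply: Linked_sym.
Qed.

(** Linking provides a point of [L] on each of the three cycles. The support of [L] does not change,
    so the result is linked again and the step can be repeated. *)
Lemma Linked_merge3 a b c l m N nu :
  Linked l (a :: b :: c :: m) N nu -> Linked l (a + b + c :: m) N nu.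
Proof.
move=> [es [ds [cs [L [f [me md] pe pd [sL pc]]]]]].
have [d1 [ds1 [q1 sd1 p1]]] := shape_cons pd.
have [d2 [ds2 [q2 sd2 p2]]] := shape_cons p1.
have [d3 [ds3 [q3 sd3 p3]]] := shape_cons p2.
have q : perm_eq ds (d1 :: d2 :: d3 :: ds3).
  rewrite (perm_trans q1) // perm_cons (perm_trans q2) // perm_cons.
  by rewrite (perm_trans q3).
have {}f := fac_perm f (perm_refl _) q (perm_refl _).
have := md; rewrite (perm_all _ q) /= => /and4P[h1 h2 h3 h4].
have [d [L' [pd' pL f']]] := fac_merge3 f h1 h2 h3.
have LL : has (mem L') =1 has (mem L).
  by move=> s; apply: eq_has => x; apply: (perm_mem pL).
exists es, (d :: ds3), cs, L'; split=> //.
- split; first by rewrite (eq_all LL).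
  rewrite /= !(eq_all LL) h4 andbT LL.
  have /hasP[x xd1 xL] := h1; apply/hasP; exists x => //.
  by rewrite (perm_mem pd') mem_cat xd1.
- by rewrite /shape /= (perm_size pd') !size_cat sd1 sd2 sd3 addnA perm_cons.
by rewrite (perm_size pL).
Qed.

(** Without a distinguished cycle the notion is stable under disjoint union, which serves to split
    fixed points off [E]. *)
Definition Factor (l m nu : seq nat) :=
  exists es ds cs : seq (seq nat),
  [/\ fac es ds cs, perm_eq (shape es) l, perm_eq (shape ds) m
    & perm_eq (shape cs) nu].

Lemma Factor_perm l m nu l' m' nu' : Factor l m nu ->
  perm_eq l l' -> perm_eq m m' -> perm_eq nu nu' -> Factor l' m' nu'.
Proof.
move=> [es [ds [cs [f pe pd pc]]]] pl pm pn.
by exists es, ds, cs; split=> //; [exact: perm_trans pl | exact: perm_trans pm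
  | exact: perm_trans pn].
Qed.

Lemma Linked_Factor l m N nu : Linked l m N nu -> Factor l m (N :: nu).
Proof.
move=> [es [ds [cs [L [f _ pe pd [<- pc]]]]]].
by exists es, ds, (L :: cs); split; rewrite //= perm_cons.
Qed.

Lemma Factor_union l1 m1 nu1 l2 m2 nu2 : Factor l1 m1 nu1 -> Factor l2 m2 nu2 ->
  Factor (l1 ++ l2) (m1 ++ m2) (nu1 ++ nu2).
Proof.
move=> [es1 [ds1 [cs1 [f1 pe1 pd1 pc1]]]] [es2 [ds2 [cs2 [f2 pe2 pd2 pc2]]]].
have [h hi dis] := disjoint_relabelling (flatten es1) es2.
have {}f2 := fac_map hi f2.
have shm (s : seq (seq nat)) : shape (map (map h) s) = shape s.
  by rewrite /shape -map_comp; apply: eq_map => x; rewrite /= size_map.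
exists (es1 ++ map (map h) es2), (ds1 ++ map (map h) ds2).
exists (cs1 ++ map (map h) cs2).
by split; first exact: fac_union; rewrite /shape map_cat perm_cat // -/(shape _) shm.
Qed.

(** * Covering by products of two classes *)

(** The identity needs checking only on the support, so [fac] can be established by computation for
    small explicit cycle lists. *)
Definition fac_test (es ds cs : seq (seq nat)) :=
  [&& uniq (flatten es), perm_eq (flatten ds) (flatten es),
      perm_eq (flatten cs) (flatten es)
    & all (fun u => cyc ds (cyc es u) == cyc cs u) (flatten es)].

Lemma fac_testP es ds cs : fac_test es ds cs -> fac es ds cs.
Proof.
case/and4P=> ue pd pc /allP e; split=> // u.
case: (boolP (u \in flatten es)) => [/e /eqP //|nu].
by rewrite (cyc_notin nu) !cyc_notin // ?(perm_mem pc) ?(perm_mem pd).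
Qed.

Lemma Linked_test es ds L cs : fac_test es ds (L :: cs) ->
  all (has (mem L)) es -> all (has (mem L)) ds ->
  Linked (shape es) (shape ds) (size L) (shape cs).
Proof. by move=> /fac_testP f he hd; exists es, ds, cs, L; split. Qed.

Lemma Factor_test es ds cs : fac_test es ds cs ->
  Factor (shape es) (shape ds) (shape cs).
Proof. by move=> /fac_testP f; exists es, ds, cs. Qed.

(** * Explicit small factorizations and ways of extending them *)

Lemma Linked_1_1 : Linked [:: 1] [:: 1] 1 [::].
Proof. exact: (@Linked_test [:: [:: 0]] [:: [:: 0]] [:: 0] [::]). Qed.

Lemma Linked_4_22 : Linked [:: 4] [:: 2; 2] 4 [::].
Proof.
exact: (@Linked_test [:: [:: 0; 1; 2; 3]] [:: [:: 0; 2]; [:: 1; 3]]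
  [:: 0; 3; 2; 1] [::]).
Qed.

Lemma Linked_2_2_1 : Linked [:: 2] [:: 2] 1 [:: 1].
Proof. exact: (@Linked_test [:: [:: 0; 1]] [:: [:: 0; 1]] [:: 0] [:: [:: 1]]). Qed.

Lemma Linked_22_22_2 : Linked [:: 2; 2] [:: 2; 2] 2 [:: 2].
Proof.
exact: (@Linked_test [:: [:: 0; 1]; [:: 2; 3]] [:: [:: 0; 2]; [:: 1; 3]]
  [:: 0; 3] [:: [:: 1; 2]]).
Qed.

Lemma Linked_5_32_2 : Linked [:: 5] [:: 3; 2] 3 [:: 2].
Proof.
exact: (@Linked_test [:: [:: 0; 1; 2; 3; 4]] [:: [:: 0; 1; 3]; [:: 2; 4]]
  [:: 0; 3; 2] [:: [:: 1; 4]]).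
Qed.

Lemma Linked_32_32_21 : Linked [:: 3; 2] [:: 3; 2] 2 [:: 2; 1].
Proof.
exact: (@Linked_test [:: [:: 0; 1; 2]; [:: 3; 4]] [:: [:: 0; 2; 3]; [:: 1; 4]]
  [:: 0; 4] [:: [:: 1; 3]; [:: 2]]).
Qed.

Lemma Linked_7_322_21 : Linked [:: 7] [:: 3; 2; 2] 4 [:: 2; 1].
Proof.
exact: (@Linked_test [:: [:: 0; 1; 2; 3; 4; 5; 6]]
  [:: [:: 0; 1; 3]; [:: 2; 6]; [:: 4; 5]]
  [:: 0; 3; 5; 2] [:: [:: 1; 6]; [:: 4]]).
Qed.

(** Each new point enters one cycle of [E] and the cycle [L], and is a fixed point of [d]. *)
Lemma Linked_lengthen k a l m N nu :
  Linked (a :: l) m N nu -> Linked (a + k :: l) (nseq k 1 ++ m) (N + k) nu.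
Proof.
move=> g; elim: k => [|k IH]; first by rewrite !addn0.
have := Linked_join_left IH Linked_1_1.
rewrite !cats0 -!addnA !addn1 => h; apply: (Linked_perm h) => //.
by rewrite perm_catC.
Qed.

(** This is the case [d = 1]; its type is written with a head entry 1 on which joins can act. *)
Lemma Linked_cycle k : Linked [:: k.+1] (1 :: nseq k 1) k.+1 [::].
Proof.
have := Linked_lengthen k Linked_1_1; rewrite add1n => h.
by apply: (Linked_perm h) => //; rewrite perm_catC.
Qed.

(** One merging of three cycles absorbs two fixed points of [d] into its cycle of length [a]; this
    is the source of the parity conditions below. *)
Lemma Linked_grow k a j l m N nu :
  Linked l (a :: nseq (k.*2 + j) 1 ++ m) N nu ->
  Linked l (a + k.*2 :: nseq j 1 ++ m) N nu.
Proof.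
elim: k a => [|k IH] a; first by rewrite addn0.
rewrite doubleS !addSn => /Linked_merge3; rewrite !addn1 => /IH.
by rewrite !addSn !addnS.
Qed.

Lemma size_le_sumn k l : all (leq k) l -> k * size l <= sumn l.
Proof.
elim: l => [|x l IH] /=; first by rewrite muln0.
by rewrite mulnS => /andP[kx /IH]; apply: leq_add.
Qed.

(** Every new cycle of [E] is strung by one of its points on the same cycle of [d], which grows by
    one; its other points become fixed points of [d], and the whole cycle is absorbed in [L]. *)
Lemma Linked_chain l2 b l m N nu : all (leq 1) l2 -> Linked l (b :: m) N nu ->
  Linked (l ++ l2) (b + size l2 :: nseq (sumn l2 - size l2) 1 ++ m)
       (N + sumn l2) nu.
Proof.
elim: l2 b l m N => [|x l2 IH] b l m N; first by rewrite cats0 !addn0.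
case: x => // x /= p g.
have := Linked_join g (Linked_cycle x); rewrite cats0 => /(IH _ _ _ _ p).
have := size_le_sumn p; rewrite mul1n => le.
rewrite -catA addn1 addSnnS -addnA => h; apply: (Linked_perm h) => //.
rewrite perm_cons; have -> : x.+1 + sumn l2 - (size l2).+1 =
  (sumn l2 - size l2) + x by lia.
by rewrite nseqD -catA perm_cat2l perm_catC.
Qed.

(** A cycle [d] through one point of each cycle of [E] turns [E] into a single cycle on all
    points. *)
Lemma Linked_tree x l : all (leq 1) (x :: l) ->
  Linked (x :: l) ((size l).+1 :: nseq (x + sumn l - (size l).+1) 1)
       (x + sumn l) [::].
Proof.
case: x => // x /= p; have := Linked_chain p (Linked_cycle x).
have := size_le_sumn p; rewrite mul1n => le h.
apply: (Linked_perm h) => //.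
by rewrite add1n perm_cons -nseqD; apply/seq.permP => P; rewrite !count_nseq; lia.
Qed.

(** Multisets are compared by counting under an arbitrary predicate [P]. A block [nseq k 1]
    contributes [P 1 * k], so splitting on the value of [P 1] leaves linear arithmetic. *)
Ltac perm_count :=
  let P := fresh "P" in
  apply/seq.permP => P; rewrite /= ?(count_cat, count_nseq) /= ?(count_cat, count_nseq) /=;
  case: (P 1) => /=; lia.

Lemma Linked_grow_to b j l a K m N nu :
  Linked l (a :: nseq K 1 ++ m) N nu ->
  a <= b -> a + K = b + j -> ~~ odd (b - a) ->
  Linked l (b :: nseq j 1 ++ m) N nu.
Proof.
move=> g ab e o; have [k ek] : exists k, b = a + k.*2.
  by exists (b - a)./2; rewrite even_halfK //; lia.
have eK : K = k.*2 + j by lia.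
by rewrite ek; apply: Linked_grow; rewrite -eK.
Qed.

Lemma Linked_grow_nil b j l a K N nu : Linked l (a :: nseq K 1) N nu ->
  a <= b -> a + K = b + j -> ~~ odd (b - a) -> Linked l (b :: nseq j 1) N nu.
Proof.
by have := @Linked_grow_to b j l a K [::] N nu; rewrite !cats0.
Qed.

Lemma perm_count_pick (p : pred nat) k l : k <= count p l ->
  exists s l' : seq nat, [/\ perm_eq l (s ++ l'), size s = k & all p s].
Proof.
rewrite -size_filter => le.
exists (take k (filter p l)), (drop k (filter p l) ++ filter (predC p) l).
split; rewrite ?size_takel //.
  by rewrite catA cat_take_drop perm_sym perm_filterC.
by apply/allP => x /mem_take; rewrite mem_filter => /andP[].
Qed.

Lemma perm_pick (p : pred nat) l : has p l ->
  exists (x : nat) (l' : seq nat), perm_eq l (x :: l') /\ p x.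
Proof.
by case/hasP=> x xl px; exists x, (rem x l); rewrite px perm_to_rem.
Qed.

(** For a permutation of cycle type [l], [odd (n - size l)] tells whether it is odd. As classes of
    the symmetric group are closed under inversion, [Factor l mu nu] places type [l] in the product
    of the classes of types [nu] and [mu]. *)
Definition parity_cover n (mu nu : seq nat) (odd_case : bool) :=
  forall l, all (leq 1) l -> sumn l = n -> odd (n - size l) = odd_case ->
  Factor l mu nu.

(** [Linked_tree] leaves an even number of fixed points in [d], and these are absorbed in pairs. For
    odd [E], in the next lemma, one of them remains. *)
Lemma Linked_n l : all (leq 1) l -> l != [::] -> ~~ odd (sumn l - size l) ->
  Linked l [:: sumn l] (sumn l) [::].
Proof.
case: l => // x l p _ /= o; have := size_le_sumn p; rewrite mul1n /= => le.
have h := Linked_tree p.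
by apply: (Linked_grow_nil (j := 0) h); lia.
Qed.

Lemma Linked_n1_1 l : all (leq 1) l -> l != [::] -> odd (sumn l - size l) ->
  Linked l [:: (sumn l).-1; 1] (sumn l) [::].
Proof.
case: l => // x l p _ /= o; have := size_le_sumn p; rewrite mul1n /= => le.
have h := Linked_tree p.
by apply: (Linked_grow_nil (j := 1) h); lia.
Qed.

(** All cycles of [E] but one are strung on the main cycle of [d]; the last is hooked to a fixed
    point of [d] instead, which creates the 2-cycle. *)
Lemma Linked_two l : all (leq 1) l -> 2 <= size l -> size l < sumn l ->
  Linked l ((size l).-1 :: nseq (sumn l - size l - 1) 1 ++ [:: 2]) (sumn l) [::].
Proof.
move=> pl sl lt.
(* A cycle of length at least 2 leaves [d] a fixed point to hook to. *)
have /perm_pick[y [l1 [q1 y2]]] : has (leq 2) l.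
  apply/negPn/negP => /hasPn h; suff : sumn l <= size l by lia.
  elim: l pl h {sl lt} => //= x l IH /andP[_ pl] h.
  have := h x (mem_head _ _); have := IH pl (fun z zl => h z (@mem_behead _ (x :: l) z zl)).
  by lia.
move: pl sl lt; rewrite (perm_all _ q1) (perm_size q1) (perm_sumn q1).
case: l1 q1 => // x l1 q1 /= /and3P[y1 x1 pl] _.
have := size_le_sumn pl; rewrite mul1n => le lt.
suff h : Linked (y :: x :: l1) ((size l1).+1 ::
    nseq (y + (x + sumn l1) - (size l1).+2 - 1) 1 ++ [:: 2])
    (y + (x + sumn l1)) [::].
  by apply: (Linked_perm h); rewrite // perm_sym.
case: x x1 q1 lt => // x _ _ lt.
have /Linked_tree : all (leq 1) (y :: l1) by rewrite /= y1.
have [k ek] : exists k, y + sumn l1 - (size l1).+1 = k.+1.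
  by exists (y + sumn l1 - (size l1).+2); lia.
rewrite ek => h0.
have h1 : Linked (y :: l1) (1 :: (size l1).+1 :: nseq k 1) (y + sumn l1) [::].
  by apply: (Linked_perm h0) => //; perm_count.
have := Linked_join h1 (Linked_cycle x).
have -> : y + sumn l1 + x.+1 = y + (x.+1 + sumn l1) by lia.
by rewrite addn1 => h; apply: (Linked_perm h) => //; perm_count.
Qed.

Lemma Linked_2_n2 l : all (leq 1) l -> 4 <= sumn l -> odd (sumn l - size l) ->
  Linked l [:: sumn l - 2; 2] (sumn l) [::].
Proof.
move=> pl n4 o; case: (ltnP 1 (size l)) => sl.
  have := Linked_two pl sl; have := size_le_sumn pl; rewrite mul1n => le h.
  have /h {}h : size l < sumn l by lia.
  by apply: (Linked_grow_to (j := 0) h); lia.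
(* What remains is a single cycle, of even length: it is obtained by lengthening the example on four
   points. *)
case: l sl o n4 pl => // x [] //= _ o n4 _; rewrite addn0 in o n4 *.
have := Linked_lengthen (x - 4) Linked_4_22.
have [k ek] : exists k, x = k + 4 by exists (x - 4); lia.
rewrite {x}ek addnK in o n4 *; rewrite addnC => h.
apply: (Linked_grow_to (a := 2) (K := k) (j := 0)); try lia.
by apply: (Linked_perm h) => //; perm_count.
Qed.

(** The seed is [(0 1)(0 1) = 1]: one fixed point of the product is grown into [L], the other stays
    as the entry 1. *)
Lemma Linked_no_fixed l : all (leq 2) l -> l != [::] ->
  Linked l ((size l).+1 :: nseq (sumn l - size l - 1) 1) (sumn l).-1 [:: 1].
Proof.
case: l => // x l /= /andP[x2 pl] _.
have := Linked_lengthen (x - 2) Linked_2_2_1; rewrite subnKC // => h.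
have {}h : Linked [:: x] (2 :: nseq (x - 2) 1) (1 + (x - 2)) [:: 1].
  by apply: (Linked_perm h) => //; perm_count.
have p1 : all (leq 1) l by apply: sub_all pl => y; lia.
have := size_le_sumn p1; rewrite mul1n => le.
have := Linked_chain p1 h.
have -> : 1 + (x - 2) + sumn l = (x + sumn l).-1 by lia.
move=> {}h; apply: (Linked_perm h) => //.
by rewrite /= add2n; perm_count.
Qed.

Lemma perm_one l : all (leq 1) l -> ~~ all (leq 2) l ->
  exists2 l' : seq nat, perm_eq l (1 :: l') & all (leq 1) l'.
Proof.
move=> pl; rewrite -has_predC => /perm_pick[x [l' [q x1]]].
move: pl; rewrite (perm_all _ q) /= => /andP[x0 pl']; exists l' => //.
by have -> : 1 = x by move: x1 => /=; lia.
Qed.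

Lemma Factor_1 : Factor [:: 1] [:: 1] [:: 1].
Proof. exact: (@Factor_test [:: [:: 0]] [:: [:: 0]] [:: [:: 0]]). Qed.

Lemma Factor_11 : Factor [:: 1; 1] [:: 2] [:: 2].
Proof. exact: (@Factor_test [:: [:: 0]; [:: 1]] [:: [:: 0; 1]] [:: [:: 0; 1]]). Qed.

(** * Pairs of classes covering all permutations of one parity *)

Lemma cover_n_even n : 1 <= n -> parity_cover n [:: n] [:: n] false.
Proof.
move=> n1 l pl sl o; apply: Linked_Factor.
rewrite -sl; apply: Linked_n => //; first by apply/eqP => e; move: sl; rewrite e /=; lia.
by rewrite sl o.
Qed.

Lemma cover_n_odd n : 1 <= n -> parity_cover n [:: n.-1; 1] [:: n] true.
Proof.
move=> n1 l pl sl o; apply: Linked_Factor.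
rewrite -sl; apply: Linked_n1_1 => //; first by apply/eqP => e; move: sl; rewrite e /=; lia.
by rewrite sl o.
Qed.

Lemma cover_n_odd2 n : 4 <= n -> parity_cover n [:: n - 2; 2] [:: n] true.
Proof.
by move=> n4 l pl sl o; apply: Linked_Factor; rewrite -sl; apply: Linked_2_n2;
  rewrite ?sl.
Qed.

Lemma cover_n1_even n : 4 <= n -> parity_cover n [:: n.-1; 1] [:: n.-1; 1] false.
Proof.
move=> n4 l pl sl o; case: (boolP (all (leq 2) l)) => [l2 | /(perm_one pl)].
  apply: Linked_Factor; have l0 : l != [::] by apply/eqP => e; move: sl; rewrite e /=; lia.
  have := Linked_no_fixed l2 l0; have := size_le_sumn l2.
  rewrite sl => le h.
  by apply: (Linked_grow_nil (j := 1) h); lia.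
case=> l' q pl'; move: sl o; rewrite (perm_sumn q) (perm_size q) /= => sl o.
have n1 : 1 <= n.-1 by lia.
have := Factor_union (cover_n_even n1 pl' _ _) Factor_1.
move=> /(_ (ltac:(lia)) (ltac:(lia))) h; apply: (Factor_perm h) => //.
by rewrite perm_sym (perm_trans q) // perm_sym perm_catC.
Qed.

Lemma cover_n1_odd n : 4 <= n ->
  parity_cover n [:: n - 2; 1; 1] [:: n.-1; 1] true.
Proof.
move=> n4 l pl sl o; case: (boolP (all (leq 2) l)) => [l2 | /(perm_one pl)].
  apply: Linked_Factor; have l0 : l != [::] by apply/eqP => e; move: sl; rewrite e /=; lia.
  have := Linked_no_fixed l2 l0; have := size_le_sumn l2.
  rewrite sl => le h.
  by apply: (Linked_grow_nil (j := 2) h); lia.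
case=> l' q pl'; move: sl o; rewrite (perm_sumn q) (perm_size q) /= => sl o.
have n1 : 1 <= n.-1 by lia.
have := Factor_union (cover_n_odd n1 pl' _ _) Factor_1.
move=> /(_ (ltac:(lia)) (ltac:(lia))) h; apply: (Factor_perm h) => //.
  by rewrite perm_sym (perm_trans q) // perm_sym perm_catC.
by have -> : n.-1.-1 = n - 2 by lia.
Qed.

Lemma Linked_pair a b : 2 <= a -> 2 <= b ->
  Linked [:: a; b] (2 :: 2 :: nseq (a + b - 4) 1) (a + b - 2) [:: 2].
Proof.
move=> a2 b2; have h1 := Linked_lengthen (a - 2) Linked_22_22_2.
have {}h1 : Linked [:: 2; a] (nseq (a - 2) 1 ++ [:: 2; 2]) a [:: 2].
  by move: h1; rewrite subnKC // => h; apply: (Linked_perm h) => //; perm_count.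
have := Linked_lengthen (b - 2) h1; rewrite subnKC //.
have -> : a + (b - 2) = a + b - 2 by lia.
by move=> h; apply: (Linked_perm h) => //; perm_count.
Qed.

Lemma ones_or_big l : all (leq 1) l ->
  (exists2 l' : seq nat, perm_eq l [:: 1, 1 & l'] & all (leq 1) l')
  \/ size l <= (count (leq 2) l).+1.
Proof.
move=> pl; have e : count (pred1 1) l + count (leq 2) l = size l.
  elim: l pl => //= x l IH /andP[x1 /IH]; rewrite eqn_leq; lia.
case: (leqP 2 (count (pred1 1) l)) => [/perm_count_pick|]; last by right; lia.
case=> s [l' [q]]; case: s q => [|x [|y []]] //= q _.
case/and3P=> /eqP ex /eqP ey _.
rewrite ex ey in q; left; exists l' => //.
by move: pl; rewrite (perm_all _ q).
Qed.

Lemma perm_big2 l : 2 <= count (leq 2) l -> all (leq 1) l ->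
  exists a b (l' : seq nat),
  [/\ perm_eq l [:: a, b & l'], 2 <= a, 2 <= b & all (leq 1) l'].
Proof.
move=> /perm_count_pick[s [l' [q]]] + + pl.
case: s q => [|x [|y []]] //= q _ /and3P[x2 y2 _].
exists x, y, l'; split=> //.
by move: pl; rewrite (perm_all _ q) => /and3P[].
Qed.

Lemma perm_big3 l : 3 <= count (leq 2) l -> all (leq 1) l ->
  exists a b c (l' : seq nat),
  [/\ perm_eq l [:: a, b, c & l'], 2 <= a, 2 <= b, 2 <= c & all (leq 1) l'].
Proof.
move=> /perm_count_pick[s [l' [q]]] + + pl.
case: s q => [|x [|y [|z []]]] //= q _ /and4P[x2 y2 z2 _].
exists x, y, z, l'; split=> //.
by move: pl; rewrite (perm_all _ q) => /and4P[].
Qed.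

(** Two fixed points of [E] can carry a 2-cycle common to [c] and [d]. With at most one fixed point,
    either [E] is an [n]-cycle, or two nontrivial cycles give [Linked_pair] and the others are
    strung on it. *)
Lemma cover_n2_even n : odd n -> 5 <= n ->
  parity_cover n [:: n - 2; 2] [:: n - 2; 2] false.
Proof.
move=> on n5 l pl sl o; case: (ones_or_big pl) => [[l' q pl'] | big].
  move: sl o; rewrite (perm_sumn q) (perm_size q) /= => sl o.
  have n1 : 1 <= n - 2 by lia.
  have := Factor_union Factor_11 (cover_n_even n1 pl' _ _).
  move=> /(_ (ltac:(lia)) (ltac:(lia))) h.
  by apply: (Factor_perm h); [rewrite perm_sym | perm_count | perm_count].
apply: Linked_Factor; case: (ltnP 1 (size l)) => sz; last first.
  case: l sz sl o {pl big} => [|x []] //=; first by lia.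
  rewrite addn0 => _ ex _; subst x.
  have := Linked_lengthen (n - 5) Linked_5_32_2; rewrite subnKC //.
  have -> : 3 + (n - 5) = n - 2 by lia.
  move=> h; apply: (Linked_grow_to (a := 3) (j := 0) (K := n - 5)); try lia.
  by apply: (Linked_perm h) => //; perm_count.
have [|a [b [l' [q a2 b2 pl']]]] := perm_big2 _ pl.
  have := size_le_sumn pl; lia.
have := Linked_chain pl' (Linked_pair a2 b2).
have := size_le_sumn pl'.
move: sl o sz; rewrite (perm_sumn q) (perm_size q) /= => sl o sz.
rewrite mul1n => le.
have -> : a + b - 2 + sumn l' = n - 2 by lia.
rewrite add2n => h.
apply: (Linked_perm (l := [:: a; b] ++ l') (m := [:: n - 2; 2]) (nu := [:: 2])) => //.
  apply: (Linked_grow_to (a := (size l').+2) (j := 0) (K := n - (size l').+4)).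
  - by apply: (Linked_perm h) => //; perm_count.
  - clear -le sl a2 b2; lia.
  - clear -le sl a2 b2; lia.
  - clear -le sl a2 b2 o. lia.
by rewrite perm_sym.
Qed.

Lemma Linked_cycle_fixed a : 6 <= a ->
  Linked [:: a; 1] (3 :: 2 :: 2 :: nseq (a - 6) 1) (a - 1) [:: 2].
Proof.
move=> a6; have := Linked_lengthen (a - 5) Linked_5_32_2.
rewrite subnKC; last lia.
have -> : a - 5 = (a - 6).+1 by lia.
move=> h; have {}h : Linked [:: a] (1 :: 3 :: 2 :: nseq (a - 6) 1) (a - 2) [:: 2].
  have -> : a - 2 = 3 + (a - 6).+1 by lia.
  by apply: (Linked_perm h) => //; perm_count.
have := Linked_join h Linked_1_1.
have -> : a - 2 + 1 = a - 1 by lia.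
by rewrite addn1 => {}h; apply: (Linked_perm h) => //; perm_count.
Qed.

(** For at least four cycles, two form the starting pair, one is hooked to a fixed point of the
    right factor to create its second 2-cycle, and the rest are strung on a 2-cycle of the pair. *)
Lemma Linked_n2_odd n l : odd n -> 7 <= n -> all (leq 1) l -> sumn l = n ->
  ~~ odd (size l) -> size l <= (count (leq 2) l).+1 ->
  Linked l (3 :: 2 :: 2 :: nseq (n - 7) 1) (n - 2) [:: 2] /\ size l = 2 \/
  Linked l ((size l).-1 :: 2 :: 2 :: nseq (n - size l - 3) 1) (n - 2) [:: 2].
Proof.
move=> on n7 pl sl o big.
case: (ltnP (size l) 3) => sz.
  case: l sz sl o big pl => [|a [|b [|]]] //=; first by lia.
  move=> _ sl _ big /and3P[a1 b1 _].
  case: (leqP 2 a) => a2; case: (leqP 2 b) => b2; last by lia.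
  - right; have := Linked_pair a2 b2.
    have -> : a + b - 2 = n - 2 by lia.
    move=> h; apply: (Linked_perm h) => //.
    have -> : a + b - 4 = (n - 2 - 3).+1 by lia.
    by perm_count.
  - left; split=> //; have [-> ->] : n - 2 = a - 1 /\ n - 7 = a - 6 by lia.
    have -> : b = 1 by lia.
    by apply: Linked_cycle_fixed; lia.
  - left; split=> //; have [-> ->] : n - 2 = b - 1 /\ n - 7 = b - 6 by lia.
    have -> : a = 1 by lia.
    have b6 : 6 <= b by lia.
    by apply: (Linked_perm (Linked_cycle_fixed b6)) => //; perm_count.
right.
have [|a [b [c [l' [q a2 b2 c2 pl']]]]] := perm_big3 _ pl.
  by lia.
move: sl o sz big; rewrite (perm_sumn q) (perm_size q) /= => sl o sz _.
case: l' q pl' sl o sz => //= d l' q /andP[d1 pl'] sl o sz.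
have pcl : all (leq 1) (c :: l') by rewrite /= pl' andbT; lia.
have := size_le_sumn pl'; rewrite mul1n => le.
have := Linked_chain pcl (Linked_pair a2 b2).
case: d d1 q sl => // d _ q sl.
(* The third long cycle ensures that the right factor still has a fixed point, to which the cycle of
   length [d.+1] is hooked. *)
have [k ek] : exists k, n - d.+1 - (size l').+4 - 1 = k.+1.
  by exists (n - d.+1 - (size l').+4 - 2); lia.
move=> h.
have {}h : Linked ([:: a; b] ++ c :: l') (1 :: (size l').+3 :: 2 :: nseq k 1)
   (a + b - 2 + sumn (c :: l')) [:: 2].
  apply: (Linked_perm h) => //; rewrite /= add2n.
  have -> : c + sumn l' - (size l').+1 = k.+1 - (a + b - 4) by lia.
  perm_count.
have := Linked_join h (Linked_cycle d).
have -> : a + b - 2 + sumn (c :: l') + d.+1 = n - 2 by rewrite /=; lia.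
rewrite addn1 => {}h; apply: (Linked_perm h) => //.
  by rewrite perm_sym (perm_trans q) //; perm_count.
perm_count.
Qed.

Lemma cover_n2_odd n : odd n -> 7 <= n ->
  parity_cover n [:: n - 4; 2; 2] [:: n - 2; 2] true.
Proof.
move=> on n7 l pl sl o; case: (ones_or_big pl) => [[l' q pl'] | big].
  move: sl o; rewrite (perm_sumn q) (perm_size q) /= => sl o.
  have n4 : 4 <= n - 2 by lia.
  have := Factor_union Factor_11 (cover_n_odd2 n4 pl' _ _).
  move=> /(_ (ltac:(lia)) (ltac:(lia))) h.
  apply: (Factor_perm h); [by rewrite perm_sym | | by perm_count].
  have -> : n - 2 - 2 = n - 4 by lia.
  by perm_count.
have := size_le_sumn pl; rewrite mul1n sl => le.
(* Long cycles use at least two points each, so with at most one fixed point [size l] is at most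
   [(n + 1) / 2], and the cycle to be grown is no longer than [n - 4]. *)
have : count (leq 2) l + size l <= n.
  rewrite -sl; elim: l pl {sl o big le} => //= x l IH /andP[x1 /IH]; lia.
move=> le2; apply: Linked_Factor.
have [|[h _]|h] := Linked_n2_odd on n7 pl sl _ big; first by lia.
  apply: (Linked_grow_to (a := 3) (K := n - 7) (j := 0) (m := [:: 2; 2])); try lia.
  by apply: (Linked_perm h) => //; perm_count.
have s0 : 0 < size l by case: (l) sl => //=; lia.
apply: (Linked_grow_to (a := (size l).-1) (K := n - size l - 3) (j := 0)
  (m := [:: 2; 2])).
  by apply: (Linked_perm h) => //; perm_count.
all: clear -le2 big n7 on o s0; lia.
Qed.

Lemma all_1_sumn l : all (leq 1) l -> sumn l <= size l -> l = nseq (size l) 1.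
Proof.
elim: l => //= x l IH /andP[x1 pl] le.
have := size_le_sumn pl; rewrite mul1n => le'.
by rewrite -IH //; [congr (_ :: _); lia | lia].
Qed.

(** This serves nine points when [E] has two fixed points. A transposition has six cycles, too many
    to be strung on a 4-cycle, and gets an explicit factorization. *)
Lemma cover_7_34 : parity_cover 7 [:: 4; 3] [:: 7] true.
Proof.
move=> l pl sl o; have := size_le_sumn pl; rewrite mul1n sl => le.
apply: Linked_Factor; case: (ltnP 5 (size l)) => sz.
  have s6 : size l = 6 by lia.
  have /perm_pick[x [l' [q x2]]] : has (leq 2) l.
    apply/negPn/negP => /hasPn h; have : sumn l <= size l; last by lia.
    elim: l pl h {sl o le sz s6} => //= x l IH /andP[_ pl] h.
    have := h x (mem_head _ _).
    by have := IH pl (fun z zl => h z (@mem_behead _ (x :: l) z zl)); lia.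
  move: sl s6 pl; rewrite (perm_sumn q) (perm_size q) (perm_all _ q) /=.
  move=> sl s6 /andP[_ pl'].
  have := size_le_sumn pl'; rewrite mul1n => le'.
  have e : l' = nseq 5 1 by rewrite (all_1_sumn pl'); [congr nseq; lia | lia].
  have ex : x = 2 by move: sl; rewrite e /=; lia.
  rewrite e ex in q.
  have := @Linked_test [:: [:: 0; 1]; [:: 2]; [:: 3]; [:: 4]; [:: 5]; [:: 6]]
    [:: [:: 0; 2; 3; 4]; [:: 1; 5; 6]] [:: 0; 5; 6; 1; 2; 3; 4] [::]
    isT isT isT => h.
  by apply: (Linked_perm h) => //; rewrite perm_sym.
case: l pl sl o le sz => // x l pl sl o le sz.
have := Linked_tree pl; rewrite -[x + _]/(sumn (x :: l)) sl => h.
have {}h : Linked (x :: l) [:: 4; 1; 1; 1] 7 [::].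
  have [e|e] : size l = 1 \/ size l = 3 by move: o sz => /=; lia.
    by move: h; rewrite e => /(@Linked_grow_nil 4 3); apply.
  by move: h; rewrite e.
have {}h : Linked (x :: l) [:: 1; 1; 1; 4] 7 [::] by apply: (Linked_perm h).
have {}h := @Linked_grow_to 3 0 _ 1 2 [:: 4] 7 [::] h isT erefl isT.
by apply: (Linked_perm h).
Qed.

(** The type [(4, 3, 2)] replaces [(5, 2, 2)] because its fourth power is a 3-cycle, while the
    exclusion of products of two disjoint transpositions is proved from ten points on. *)
Lemma cover_9_342 : parity_cover 9 [:: 4; 3; 2] [:: 7; 2] true.
Proof.
move=> l pl sl o; case: (ones_or_big pl) => [[l' q pl'] | big].
  move: sl o; rewrite (perm_sumn q) (perm_size q) /= => sl o.
  have := Factor_union Factor_11 (cover_7_34 pl' _ _).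
  move=> /(_ (ltac:(lia)) (ltac:(lia))) h.
  by apply: (Factor_perm h); rewrite // perm_sym.
have := size_le_sumn pl; rewrite mul1n sl => le.
have : count (leq 2) l + size l <= 9.
  rewrite -sl; elim: l pl {sl o big le} => //= x l IH /andP[x1 /IH]; lia.
move=> le2; apply: Linked_Factor.
have s0 : 0 < size l by case: (l) sl => //=; lia.
have ev : ~~ odd (size l) by lia.
have h322 : Linked l [:: 3; 2; 2; 1; 1] 7 [:: 2] -> Linked l [:: 4; 3; 2] 7 [:: 2].
  move=> h; have {}h : Linked l [:: 2; 1; 1; 3; 2] 7 [:: 2] by apply: (Linked_perm h).
  exact: (@Linked_grow_to 4 0 _ 2 2 [:: 3; 2] 7 [:: 2] h isT erefl isT).
have [[h _]|] := @Linked_n2_odd 9 l isT isT pl sl ev big; first exact: h322.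
have [->|->] : size l = 2 \/ size l = 4 by clear -ev le2 big s0; lia.
  move=> h; have {}h : Linked l [:: 2; 1; 1; 1; 1; 1; 2] 7 [:: 2].
    by apply: (Linked_perm h).
  have {}h := @Linked_grow_to 4 3 _ 2 5 [:: 2] 7 [:: 2] h isT erefl isT.
  have {}h : Linked l [:: 1; 1; 1; 4; 2] 7 [:: 2] by apply: (Linked_perm h).
  have {}h := @Linked_grow_to 3 0 _ 1 2 [:: 4; 2] 7 [:: 2] h isT erefl isT.
  by apply: (Linked_perm h).
exact: h322.
Qed.

(** Only three odd types exist on five points, and each has an explicit factorization. *)
Lemma cover_5_311 : parity_cover 5 [:: 3; 1; 1] [:: 3; 2] true.
Proof.
have h2111 : Factor [:: 2; 1; 1; 1] [:: 3; 1; 1] [:: 3; 2].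
  apply: (Factor_perm (@Factor_test [:: [:: 0; 1]; [:: 2]; [:: 3]; [:: 4]]
    [:: [:: 2; 3; 4]; [:: 0]; [:: 1]] [:: [:: 2; 3; 4]; [:: 0; 1]] isT)) => //.
have h41 : Factor [:: 4; 1] [:: 3; 1; 1] [:: 3; 2].
  apply: (Factor_perm (@Factor_test [:: [:: 0; 1; 2; 3]; [:: 4]]
    [:: [:: 0; 1; 4]; [:: 2]; [:: 3]] [:: [:: 1; 2; 3]; [:: 0; 4]] isT)) => //.
have h32 : Factor [:: 3; 2] [:: 3; 1; 1] [:: 3; 2].
  apply: (Factor_perm (@Factor_test [:: [:: 0; 1; 2]; [:: 3; 4]]
    [:: [:: 0; 1; 2]; [:: 3]; [:: 4]] [:: [:: 0; 2; 1]; [:: 3; 4]] isT)) => //.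
have rec a b c : perm_eq a b -> Factor b c [:: 3; 2] -> Factor a c [:: 3; 2].
  by move=> p h; apply: (Factor_perm h); rewrite // perm_sym.
case=> [|a [|b [|c [|d [|e l]]]]] //= pl sl o; try lia.
  have eb : b = 5 - a by lia.
  rewrite {b}eb in pl sl o *; case: a pl sl o => [|[|[|[|[|a]]]]] //= _ _ _.
  - by apply: (rec _ _ _ _ h41).
  - by apply: (rec _ _ _ _ h32).
  have : a = 1 /\ b = 1 /\ c = 1 /\ d = 2 \/ a = 1 /\ b = 1 /\ c = 2 /\ d = 1
      \/ a = 1 /\ b = 2 /\ c = 1 /\ d = 1 \/ a = 2 /\ b = 1 /\ c = 1 /\ d = 1.
    by lia.
  by case=> [|[|[|]]] [-> [-> [-> ->]]]; apply: (rec _ _ _ _ h2111).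
Qed.

Lemma Linked_cycle2 a : 2 <= a ->
  Linked [:: a] (2 :: nseq (a - 2) 1) (a - 1) [:: 1].
Proof.
move=> a2; have := Linked_lengthen (a - 2) Linked_2_2_1; rewrite subnKC //.
have -> : 1 + (a - 2) = a - 1 by lia.
by move=> h; apply: (Linked_perm h) => //; perm_count.
Qed.

(** A 2-cycle of the pair and the 2-cycle attached to the third cycle merge into the 4-cycle. *)
Lemma Linked_triple a b c : 2 <= a -> 2 <= b -> 2 <= c ->
  Linked [:: a; b; c] (4 :: 2 :: nseq (a + b + c - 6) 1) (a + b + c - 3) [:: 2; 1].
Proof.
move=> a2 b2 c2; have := Linked_join (Linked_pair a2 b2) (Linked_cycle2 c2).
have -> : a + b - 2 + (c - 1) = a + b + c - 3 by lia.
by rewrite -[2 + 2]/4 => h; apply: (Linked_perm h) => //; perm_count.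
Qed.

Lemma Linked_pair21 a b : 3 <= a -> 2 <= b ->
  Linked [:: a; b] (3 :: 2 :: nseq (a + b - 5) 1) (a + b - 3) [:: 2; 1].
Proof.
move=> a3 b2; have := Linked_lengthen (a - 3) Linked_32_32_21; rewrite subnKC //.
move=> h1; have {}h1 : Linked [:: 2; a] (nseq (a - 3) 1 ++ [:: 3; 2]) (2 + (a - 3)) [:: 2; 1].
  by apply: (Linked_perm h1) => //; perm_count.
have := Linked_lengthen (b - 2) h1; rewrite subnKC //.
have -> : 2 + (a - 3) + (b - 2) = a + b - 3 by lia.
by move=> h; apply: (Linked_perm h) => //; perm_count.
Qed.

Lemma sub_all21 l : all (leq 2) l -> all (leq 1) l.
Proof. by apply: sub_all => x; apply: ltnW. Qed.

(** A fixed point of [E] reduces to [cover_n2_even] on the odd number [n.-1] of points. Otherwise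
    the number of cycles is even: two cycles give [Linked_pair21], and more give [Linked_triple]
    with the others strung on it. *)
Lemma cover_n3_even n : ~~ odd n -> 6 <= n ->
  parity_cover n [:: n - 3; 2; 1] [:: n - 3; 2; 1] false.
Proof.
move=> en n6 l pl sl o; case: (boolP (all (leq 2) l)) => [l2 | /(perm_one pl)].
  have := size_le_sumn l2; rewrite sl => le.
  have s0 : 0 < size l by case: (l) sl => //=; lia.
  apply: Linked_Factor; case: l pl sl o l2 le s0 => [|a [|b [|c l]]] //.
  - by move=> _; rewrite /= addn0; lia.
  - move=> _ sl _ /and3P[a2 b2 _] _ _; rewrite /= addn0 in sl.
    suff h : Linked [:: a; b] (3 :: 2 :: nseq (n - 5) 1) (n - 3) [:: 2; 1].
      apply: (Linked_perm (m := n - 3 :: nseq 1 1 ++ [:: 2])) => //; last by perm_count.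
      apply: (Linked_grow_to (a := 3) (K := n - 5)); try lia.
      by apply: (Linked_perm h) => //; perm_count.
    case: (leqP 3 a) => a3.
      by have := Linked_pair21 a3 b2; rewrite sl.
    have b3 : 3 <= b by lia.
    have := Linked_pair21 b3 a2; rewrite addnC sl => h.
    by apply: (Linked_perm h) => //; perm_count.
  move=> _ sl o /and4P[a2 b2 c2 l2] le _.
  have pl := sub_all21 l2.
  have := Linked_chain pl (Linked_triple a2 b2 c2).
  have := size_le_sumn l2; rewrite /= in sl o le *.
  have -> : a + b + c - 3 + sumn l = n - 3 by lia.
  move=> le2 h.
  apply: (Linked_perm (m := n - 3 :: nseq 1 1 ++ [:: 2])) => //; last by perm_count.
  apply: (Linked_grow_to (a := 4 + size l) (K := n - size l - 6));
    try by [clear -le le2 en n6 o sl a2 b2 c2; lia].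
  by apply: (Linked_perm h) => //; perm_count.
case=> l' q pl'; move: sl o; rewrite (perm_sumn q) (perm_size q) /= => sl o.
have n1 : 5 <= n.-1 by lia.
have on : odd n.-1 by lia.
have := Factor_union (cover_n2_even on n1 pl' _ _) Factor_1.
move=> /(_ (ltac:(lia)) (ltac:(lia))).
have -> : n.-1 - 2 = n - 3 by lia.
move=> h; apply: (Factor_perm h) => //.
by rewrite perm_sym (perm_trans q) // perm_sym perm_catC.
Qed.

Lemma cover_n3_odd n : ~~ odd n -> 8 <= n ->
  parity_cover n [:: n - 5; 2; 2; 1] [:: n - 3; 2; 1] true.
Proof.
move=> en n8 l pl sl o; case: (boolP (all (leq 2) l)) => [l2 | /(perm_one pl)].
  have := size_le_sumn l2; rewrite sl => le.
  have s0 : 0 < size l by case: (l) sl => //=; lia.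
  (* An odd cycle beside two 2-cycles is enough: since [n - 5] is odd, it can be grown to that
     length, leaving one fixed point. *)
  suff [a [h la al]] : exists a, [/\ Linked l (a :: nseq (n - a - 4) 1 ++ [:: 2; 2])
      (n - 3) [:: 2; 1], odd a & a <= n - 5].
    apply: Linked_Factor.
    apply: (Linked_perm (m := n - 5 :: nseq 1 1 ++ [:: 2; 2])) => //; last by perm_count.
    by apply: (Linked_grow_to h) => //; lia.
  case: (leqP 5 (size l)) => sz.
    (* The triple accounts for length 4 and each strung cycle for one more; the fourth cycle is
       hooked to a fixed point and gives the second 2-cycle. *)
    exists (size l).
    case: l pl sl o l2 le s0 sz => [|a [|b [|c [|d l]]]] // _ sl o.
    case/and5P=> a2 b2 c2 d2 l2 le _ sz.
    have := Linked_chain (sub_all21 l2) (Linked_triple a2 b2 c2).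
    have := size_le_sumn l2; rewrite /= in sl o le sz *.
    move=> le2 h.
    have [k ek] : exists k, n - d - size l - 6 = k.+1.
      by exists (n - d - size l - 7); clear -le le2 sl sz a2 b2 c2; lia.
    have {}h : Linked ([:: a; b; c] ++ l) (1 :: 4 + size l :: 2 :: nseq k 1)
       (n - d - 3) [:: 2; 1].
      have -> : n - d - 3 = a + b + c - 3 + sumn l by lia.
      by apply: (Linked_perm h) => //; perm_count.
    case: d d2 sl ek h => // d d2 sl ek h.
    have := Linked_join h (Linked_cycle d); rewrite addn1.
    have -> : n - d.+1 - 3 + d.+1 = n - 3 by lia.
    move=> {}h; split; try by clear -o en le sz n8; lia.
    apply: (Linked_perm h) => //; first by perm_count.
    by rewrite add4n; perm_count.
  have {s0} [s|s] : size l = 1 \/ size l = 3 by clear -s0 o en sz; lia.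
    exists 3; split=> //; last by lia.
    case: l s sl {pl o l2 le sz} => // a [] //= _; rewrite addn0 => ->.
    have := Linked_lengthen (n - 7) Linked_7_322_21; rewrite subnKC; last by lia.
    have -> : 4 + (n - 7) = n - 3 by lia.
    by move=> h; apply: (Linked_perm h) => //; perm_count.
  exists 3; split=> //; last by lia.
  (* Three cycles on at least 8 points include one of length at least 3. Its 2-cycle in
     [Linked_cycle2] leaves a fixed point, which is joined to a 2-cycle of the pair to form the
     3-cycle. *)
  have /perm_pick[c [l' [q c3]]] : has (leq 3) l.
    apply/negPn/negP => /hasPn h; have : sumn l <= 2 * size l; last by lia.
    elim: l l2 h {pl sl o le sz s} => //= x l IH /andP[_ l2] h.
    have := h x (mem_head _ _).
    by have := IH l2 (fun z zl => h z (@mem_behead _ (x :: l) z zl)); lia.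
  move: l2 s sl; rewrite (perm_all _ q) (perm_size q) (perm_sumn q).
  case: l' q => [|a [|b []]] //= q /and4P[c2 a2 b2 _] _.
  rewrite addn0 => sl.
  have h1 := Linked_cycle2 c2.
  have {}h1 : Linked [:: c] (1 :: 2 :: nseq (c - 3) 1) (c - 1) [:: 1].
    by apply: (Linked_perm h1) => //; perm_count.
  have h2 := Linked_pair a2 b2.
  have := Linked_join h1 h2; rewrite add1n.
  have -> : c - 1 + (a + b - 2) = n - 3 by lia.
  move=> h; apply: (Linked_perm h) => //; first by rewrite perm_sym.
  by perm_count.
case=> l' q pl'; move: sl o; rewrite (perm_sumn q) (perm_size q) /= => sl o.
have n1 : 7 <= n.-1 by lia.
have on : odd n.-1 by lia.
have := Factor_union (cover_n2_odd on n1 pl' _ _) Factor_1.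
move=> /(_ (ltac:(lia)) (ltac:(lia))).
have [-> ->] : n.-1 - 2 = n - 3 /\ n.-1 - 4 = n - 5 by lia.
move=> h; apply: (Factor_perm h) => //.
by rewrite perm_sym (perm_trans q) // perm_sym perm_catC.
Qed.

Lemma cover_6_3111 : parity_cover 6 [:: 3; 1; 1; 1] [:: 3; 2; 1] true.
Proof.
move=> l pl sl o; case: (boolP (all (leq 2) l)) => [l2 | /(perm_one pl)].
  have := size_le_sumn l2; rewrite sl => le.
  case: l pl sl o l2 le => [|a [|b [|c [|d l]]]] //=; try lia.
    rewrite addn0 => _ -> _ _ _.
    by apply: (Factor_perm (@Factor_test [:: [:: 0; 1; 2; 3; 4; 5]]
      [:: [:: 0; 3; 1]; [:: 2]; [:: 4]; [:: 5]]
      [:: [:: 3; 4; 5]; [:: 1; 2]; [:: 0]] isT)).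
  move=> _ sl _ l2 _; have [-> [-> ->]] : a = 2 /\ b = 2 /\ c = 2 by lia.
  by apply: (Factor_perm (@Factor_test [:: [:: 0; 1]; [:: 2; 3]; [:: 4; 5]]
    [:: [:: 0; 1; 2]; [:: 3]; [:: 4]; [:: 5]]
    [:: [:: 0; 2; 3]; [:: 4; 5]; [:: 1]] isT)).
case=> l' q pl'; move: sl o; rewrite (perm_sumn q) (perm_size q) /= => sl o.
have := Factor_union (cover_5_311 pl' _ _) Factor_1.
move=> /(_ (ltac:(lia)) (ltac:(lia))) h.
apply: (Factor_perm h) => //.
by rewrite perm_sym (perm_trans q) // perm_sym perm_catC.
Qed.

Local Open Scope group_scope.

(** * Cycle types of permutations *)

Lemma shape_perm (T : eqType) (cs : seq (seq T)) m :
  perm_eq (shape cs) m -> exists2 ds, perm_eq cs ds & shape ds = m.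
Proof.
elim: m cs => [|a m IH] cs p.
  by exists cs => //; apply: size0nil; rewrite (perm_size p).
have [c [cs' [q <- /IH[ds pd <-]]]] := shape_cons p.
by exists (c :: ds) => //; apply: (perm_trans q); rewrite perm_cons.
Qed.

Lemma relabelling (T : finType) (S : eqType) (d : S)
    (cs : seq (seq T)) (ds : seq (seq S)) :
  perm_eq (flatten cs) (enum T) -> uniq (flatten ds) ->
  perm_eq (shape ds) (shape cs) ->
  exists2 h : T -> S, injective h & perm_eq (map (map h) cs) ds.
Proof.
move=> pc ud /shape_perm[ds' pd sd]; have pf := perm_flatten pd.
have uc : uniq (flatten cs) by rewrite (perm_uniq pc) enum_uniq.
have sz : size (flatten cs) = size (flatten ds') by rewrite !size_flatten sd.
have mc x : x \in flatten cs by rewrite (perm_mem pc) mem_enum.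
pose h x := nth d (flatten ds') (index x (flatten cs)).
exists h => [x y /eqP|].
  rewrite /h nth_uniq -?sz ?index_mem -?(perm_uniq pf) // => /eqP e.
  by rewrite -(nth_index x (mc x)) e nth_index.
suff -> : map (map h) cs = ds' by rewrite perm_sym.
apply: eq_from_flatten_shape; last first.
  by rewrite sd /shape -map_comp; apply: eq_map => s; rewrite /= size_map.
rewrite -map_flatten; apply: (@eq_from_nth _ d); rewrite size_map // => i lt.
case: (flatten cs) mc uc lt @h {pc sz} => // x s mc uc lt h.
by rewrite (nth_map x) // /h index_uniq.
Qed.

Section CycleTypes.

Variable T : finType.
Implicit Types (g s : {perm T}) (m l : seq nat) (x y : T).

(** Fixed points are listed as cycles of length 1, so [m] is a partition of [#|T|], taken in some
    order. *)
Definition has_type g m := exists cs : seq (seq T),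
  [/\ perm_eq (flatten cs) (enum T), shape cs = m & g =1 cyc cs].

Lemma has_type_perm g m m' : perm_eq m m' -> has_type g m -> has_type g m'.
Proof.
move=> p [cs [pc sc e]]; subst m; have [ds pd sd] := shape_perm p.
have uc : uniq (flatten cs) by rewrite (perm_uniq pc) enum_uniq.
exists ds; split=> //.
  by rewrite perm_sym (perm_trans _ (perm_flatten pd)) // perm_sym.
by move=> x; rewrite e (eq_cyc pd).
Qed.

Lemma perm_cyc (cs : seq (seq T)) : uniq (flatten cs) ->
  exists g, g =1 cyc cs.
Proof.
by move=> uc; exists (perm (can_inj (cyc_rev uc))) => x; rewrite permE.
Qed.

Lemma has_type_exists m : sumn m = #|T| -> exists g, has_type g m.
Proof.
rewrite cardE => sm; pose cs := reshape m (enum T).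
have f : flatten cs = enum T by rewrite reshapeKr // sm.
have [|g eg] := @perm_cyc cs; first by rewrite f enum_uniq.
by exists g, cs; split; rewrite ?f // reshapeKl // sm.
Qed.

Lemma mem_orbit_porbit g x : fingraph.orbit g x =i porbit g x.
Proof.
move=> y; rewrite -fconnect_orbit; apply/idP/idP.
  by move/iter_findex <-; rewrite -permX mem_porbit.
by case/porbitP=> i ->; rewrite permX fconnect_iter.
Qed.

Lemma has_type_total g : exists l, [/\ has_type g l, all (leq 1) l,
  sumn l = #|T| & odd_perm g = odd (#|T| - size l)].
Proof.
(* The empty default is never reached on an orbit, which has a point. *)
pose f (B : {set T}) := if [pick x in B] is Some x then fingraph.orbit g x else [::].
have fE (B : {set T}) : B \in porbits g ->
    [/\ f B =i B, uniq (f B) & {in f B, next (f B) =1 g}].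
  case/imsetP=> x _ ->; rewrite /f; case: pickP => [y|/(_ x)]; last first.
    by rewrite porbit_id.
  rewrite -eq_porbit_mem => /eqP ey; split; first 2 last.
  - by move=> z; apply: nextE; apply: cycle_orbit; apply: perm_inj.
  - by move=> z; rewrite mem_orbit_porbit ey.
  - exact: orbit_uniq.
pose cs := [seq f B | B <- enum (porbits g)].
have ucs : uniq (flatten cs).
  rewrite /cs; have := enum_uniq (mem (porbits g)).
  have : {subset enum (porbits g) <= porbits g} by move=> B; rewrite mem_enum.
  elim: (enum _) => //= B s IH sub /andP[Bs us].
  have [fB uB _] := fE B (sub B (mem_head _ _)).
  have sub' : {subset s <= porbits g}.
    by move=> B' B's; apply: sub; rewrite inE B's orbT.
  rewrite cat_uniq uB IH // andbT /=; apply/hasPn => x /flattenP[c].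
  case/mapP=> B' B's -> xB'; have [fB' _ _] := fE B' (sub' _ B's).
  apply: contra Bs; rewrite /= fB => xB; rewrite fB' in xB'.
  have /imsetP[y _ ey] := sub B (mem_head _ _).
  have /imsetP[y' _ ey'] := sub' _ B's.
  move: xB xB'; rewrite ey ey' -!eq_porbit_mem => /eqP <- /eqP e.
  by rewrite e -ey'.
have mcs x : x \in flatten cs.
  apply/flattenP; have xg : porbit g x \in porbits g by apply: imset_f.
  exists (f (porbit g x)); first by apply: map_f; rewrite mem_enum.
  by have [-> _ _] := fE _ xg; rewrite porbit_id.
have pcs : perm_eq (flatten cs) (enum T).
  by apply: uniq_perm; rewrite ?enum_uniq // => x; rewrite mcs mem_enum.
exists (shape cs); split.
- exists cs; split=> // x; have /flattenP[c ccs xc] := mcs x.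
  rewrite (cyc_in ucs ccs xc); case/mapP: ccs xc => B.
  by rewrite mem_enum => /fE[_ _ e] -> /e ->.
- rewrite !all_map; apply/allP => B; rewrite mem_enum => Bg /=.
  have [fB _ _] := fE B Bg; case/imsetP: Bg => x _ ey.
  have : x \in f B by rewrite fB ey porbit_id.
  by case: (f B).
- by rewrite -size_flatten (perm_size pcs) cardE.
rewrite !size_map -cardE oddB //; exact: leq_imset_card.
Qed.

Lemma has_type_conj g s m : has_type g m -> has_type (g ^ s) m.
Proof.
move=> [cs [pc sc e]].
have uc : uniq (flatten cs) by rewrite (perm_uniq pc) enum_uniq.
exists (map (map s) cs); split.
- apply: uniq_perm; rewrite ?enum_uniq -?map_flatten ?map_inj_uniq //.
    exact: perm_inj.
  move=> x; rewrite mem_enum -[x](permKV s) mem_map; last exact: perm_inj.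
  by rewrite (perm_mem pc) mem_enum.
- rewrite -sc /shape -map_comp; apply: eq_map => c; exact: size_map.
move=> x; rewrite -[x](permKV s) permJ e cyc_map //; exact: perm_inj.
Qed.

Lemma has_type_conjugate g g' m : has_type g m -> has_type g' m ->
  exists s, g' = g ^ s.
Proof.
move=> [cs [pc sc e]] [cs' [pc' sc' e']].
have uc : uniq (flatten cs) by rewrite (perm_uniq pc) enum_uniq.
have uc' : uniq (flatten cs') by rewrite (perm_uniq pc') enum_uniq.
case: (pickP T) => [x0 _|T0]; last first.
  by exists 1; apply/permP => x; have := T0 x.
have [|h hi p] := relabelling x0 pc uc'; first by rewrite sc sc'.
exists (perm hi); apply/permP => y; rewrite -[y](permKV (perm hi)).
set x := _ y; rewrite permJ e e' permE permE -(eq_cyc p) ?cyc_map //.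
by rewrite (perm_uniq (perm_flatten p)).
Qed.

Lemma has_type_inv g m : has_type g m -> has_type g^-1 m.
Proof.
move=> [cs [pc sc e]].
have uc : uniq (flatten cs) by rewrite (perm_uniq pc) enum_uniq.
exists (map rev cs); split.
- apply: perm_trans pc; elim: cs {sc e uc} => //= c cs IH.
  by rewrite perm_cat // perm_rev.
- by rewrite -sc /shape -map_comp; apply: eq_map => c; exact: size_rev.
by move=> x; rewrite -[in RHS](permKV g x) e cyc_rev.
Qed.

(** The injection [h] carries the cycles of [g] to those of the abstract left factor; the other two
    cycle lists are pulled back along the partial inverse [k] of [h]. *)
Lemma Factor_has_type (x0 : T) g l m nu : has_type g l -> Factor l m nu ->
  exists c d, [/\ has_type c nu, has_type d m & g * d = c].
Proof.
move=> [es0 [pe0 se0 eg]] [es [ds [cs [f pe sd sc]]]].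
have [ue pd pc _] := f.
have [|h hi p] := relabelling 0 pe0 ue; first by rewrite se0.
have {f} [_ _ _ f] : fac (map (map h) es0) ds cs.
  by apply: (fac_perm f) => //; rewrite perm_sym.
have ue0 : uniq (flatten es0) by rewrite (perm_uniq pe0) enum_uniq.
have pe1 : perm_eq (map h (flatten es0)) (flatten es).
  by rewrite map_flatten; apply: perm_flatten.
pose k (y : nat) := odflt x0 [pick x | h x == y].
have hk : {in flatten es, cancel k h}.
  move=> y; rewrite -(perm_mem pe1).
  case/mapP=> x _ ->; rewrite /k.
  by case: pickP => [z /eqP //|/(_ x)]; rewrite eqxx.
have typ (bs : seq (seq nat)) m' : perm_eq (flatten bs) (flatten es) ->
    perm_eq (shape bs) m' -> exists2 b, has_type b m' &
    forall x, h (b x) = cyc bs (h x).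
  move=> pb sb; pose bs0 := map (map k) bs.
  have eb : map (map h) bs0 = bs.
    rewrite -map_comp -[RHS]map_id; apply/eq_in_map => c cb.
    rewrite /= -map_comp -[RHS]map_id; apply/eq_in_map => y yc.
    by apply: hk; rewrite -(perm_mem pb); apply/flattenP; exists c.
  have pb0 : perm_eq (flatten bs0) (enum T).
    apply: perm_trans pe0; apply: (perm_map_inj hi).
    by rewrite map_flatten eb (perm_trans pb) // perm_sym.
  have ub0 : uniq (flatten bs0) by rewrite (perm_uniq pb0) enum_uniq.
  have [b bE] := perm_cyc ub0; exists b; last first.
    by move=> x; rewrite bE -cyc_map // eb.
  apply: (has_type_perm sb); exists bs0; split=> //.
  transitivity (shape (map (map h) bs0)); last by rewrite eb.
  by rewrite /shape -[RHS]map_comp; apply: eq_map => c; rewrite /= size_map.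
have [c tc cE] := typ cs nu pc sc; have [d td dE] := typ ds m pd sd.
exists c, d; split=> //; apply/permP => x; apply: (hi).
by rewrite permM dE cE eg -cyc_map ?f.
Qed.

End CycleTypes.

(** * Powers that isolate a few short cycles *)

Section Powers.

Variable T : finType.
Implicit Types (g : {perm T}) (m : seq nat) (c : seq T) (cs : seq (seq T)).

Lemma cyc_fcycle g cs c : uniq (flatten cs) -> g =1 cyc cs -> c \in cs ->
  fcycle g c /\ uniq c.
Proof.
move=> uc e cc; have uq : uniq c.
  elim: cs uc cc {e} => //= c0 cs IH; rewrite cat_uniq => /and3P[u0 _ us].
  by rewrite inE => /predU1P[-> | /IH ->].
split=> //; have := cycle_next uq; congr is_true.
by apply: eq_in_cycle (allss c) => x y xc _ /=; rewrite e (cyc_in uc cc xc).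
Qed.

Lemma cycle_pow_connect g c x y : fcycle g c -> x \in c -> y \in c ->
  exists k, (g ^+ k) x = y.
Proof.
move=> fc xc; rewrite -(fconnect_cycle fc xc) => /iter_findex <-.
by exists (findex g x y); rewrite permX.
Qed.

Lemma cycle_pow_id g c x k : fcycle g c -> uniq c -> x \in c ->
  size c %| k -> (g ^+ k) x = x.
Proof.
move=> fc uc xc /dvdnP[j ->]; rewrite mulnC expgM permX.
elim: j => //= j ->; rewrite permX -(order_cycle fc uc xc).
exact: iter_order (@perm_inj _ g) x.
Qed.

Definition cycle3 (x y z : T) := tperm x y * tperm x z.

Lemma cycle3E x y z u : uniq [:: x; y; z] -> cycle3 x y z u =
  if u == x then y else if u == y then z else if u == z then x else u.
Proof.
rewrite /= !inE negb_or => /and3P[/andP[xy xz] yz _].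
have tD (a b v : T) : v != a -> v != b -> tperm a b v = v.
  by move=> va vb; rewrite tpermD // eq_sym.
rewrite permM; case: (u =P x) => [->|/eqP ux].
  by rewrite tpermL tD // eq_sym.
case: (u =P y) => [->|/eqP uy]; first by rewrite tpermR tpermL.
rewrite (tD x y) //; case: (u =P z) => [->|/eqP uz]; first by rewrite tpermR.
by rewrite tD.
Qed.

Lemma cycle3_split (a b c d : T) : uniq [:: a; b; c; d] ->
  cycle3 a b d = cycle3 c b d * cycle3 a b c
  /\ cycle3 a b d = cycle3 a b c * cycle3 a c d.
Proof.
rewrite /= !inE !negb_or => /and4P[/and3P[ab ac ad] /andP[bc bd] cd _].
have D := (eqxx, negbTE ab, negbTE ac, negbTE ad, negbTE bc, negbTE bd,
  negbTE cd, eq_sym b a, eq_sym c a, eq_sym d a, eq_sym c b, eq_sym d b,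
  eq_sym d c).
have u3 : [/\ uniq [:: a; b; d], uniq [:: c; b; d], uniq [:: a; b; c]
    & uniq [:: a; c; d]] by rewrite /= !inE !D.
case: u3 => u1 u2 u3 u4.
split; apply/permP => w; rewrite permM !cycle3E //.
all: have [?|wa] := eqVneq w a; [subst w | have [?|wb] := eqVneq w b;
  [subst w | have [?|wc] := eqVneq w c; [subst w | have [?|wd] := eqVneq w d;
  [subst w | by rewrite !(negbTE wa, negbTE wb, negbTE wc, negbTE wd)]]]];
  by rewrite ?D //= ?D //= ?D.
Qed.

Lemma cycle3J x y z s : cycle3 x y z ^ s = cycle3 (s x) (s y) (s z).
Proof. by rewrite /cycle3 conjMg !tpermJ. Qed.

Lemma cycle3V x y z : uniq [:: x; y; z] -> (cycle3 x y z)^-1 = cycle3 x z y.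
Proof. by rewrite /cycle3 invMg !tpermV. Qed.

(** The exponent is 1 modulo the lengths in [cs1] and 0 modulo those in [cs2], so the power keeps
    the first cycles and kills the others. *)
Lemma pow_part g cs1 cs2 k u :
  perm_eq (flatten (cs1 ++ cs2)) (enum T) -> g =1 cyc (cs1 ++ cs2) -> 0 < k ->
  all (fun c => size c %| k.-1) cs1 -> all (fun c => size c %| k) cs2 ->
  (g ^+ k) u = if u \in flatten cs1 then g u else u.
Proof.
move=> pc e k0 /allP d1 /allP d2.
have uc : uniq (flatten (cs1 ++ cs2)) by rewrite (perm_uniq pc) enum_uniq.
case: ifP => [/flattenP[c cc uc1] | /negbT nu].
  have [|fc u1] := cyc_fcycle (c := c) uc e; first by rewrite mem_cat cc.
  by rewrite -(prednK k0) expgSr permM (cycle_pow_id fc u1) // d1.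
have : u \in flatten (cs1 ++ cs2) by rewrite (perm_mem pc) mem_enum.
rewrite flatten_cat mem_cat (negbTE nu) => /flattenP[c cc uc2].
have [|fc u2] := cyc_fcycle (c := c) uc e; first by rewrite mem_cat cc orbT.
by rewrite (cycle_pow_id fc u2) // d2.
Qed.

Lemma pow_tperm g m k : has_type g (2 :: m) -> all (dvdn^~ k) m -> odd k ->
  exists x y, x != y /\ g ^+ k = tperm x y.
Proof.
move=> [[|c cs] [pc sc e]] // hm ok.
have uc : uniq (flatten (c :: cs)) by rewrite (perm_uniq pc) enum_uniq.
have [fc u2] := cyc_fcycle uc e (mem_head _ _).
case: sc hm => sz <-; rewrite all_map => hm.
case: c sz pc e uc fc u2 => [|x [|y []]] // _ pc e uc f2 u2.
have xy : x != y by move: u2; rewrite /= inE andbT.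
have [gx gy] : g x = y /\ g y = x.
  by move: f2; rewrite /= andbT => /andP[/eqP -> /eqP ->].
exists x, y; split=> //; apply/permP => u.
rewrite (@pow_part g [:: [:: x; y]] cs) //=; first last.
- by rewrite andbT dvdn2; case: (k) ok => //= ?; rewrite negbK.
- by case: (k) ok.
rewrite !inE; case: tpermP => [->|->|/eqP/negbTE -> /eqP/negbTE -> //].
  by rewrite eqxx.
by rewrite eqxx orbT.
Qed.

Lemma pow_cycle3 g m k : has_type g (3 :: m) -> all (dvdn^~ k) m ->
  k %% 3 = 1%N -> exists x y z : T, uniq [:: x; y; z] /\ g ^+ k = cycle3 x y z.
Proof.
move=> [[|c cs] [pc sc e]] // hm ok.
have uc : uniq (flatten (c :: cs)) by rewrite (perm_uniq pc) enum_uniq.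
have [fc u3] := cyc_fcycle uc e (mem_head _ _).
case: sc hm => sz <-; rewrite all_map => hm.
case: c sz pc e uc fc u3 => [|x [|y [|z []]]] // _ pc e uc f3 u3.
have [gx gy gz] : [/\ g x = y, g y = z & g z = x].
  by move: f3; rewrite /= andbT => /and3P[/eqP -> /eqP -> /eqP ->].
exists x, y, z; split=> //; apply/permP => u.
rewrite (@pow_part g [:: [:: x; y; z]] cs) //=; first last.
- by rewrite andbT; lia.
- by lia.
rewrite !inE cycle3E //; case: eqP => [-> //|_].
by case: eqP => [-> //|_]; case: eqP => [->|].
Qed.

Lemma pow_tperm2 g m k : has_type g [:: 2, 2 & m] -> all (dvdn^~ k) m ->
  odd k -> exists a b c d : T,
  uniq [:: a; b; c; d] /\ g ^+ k = tperm a b * tperm c d.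
Proof.
move=> [[|c1 [|c2 cs]] [pc sc e]] // hm ok.
have uc : uniq (flatten [:: c1, c2 & cs]) by rewrite (perm_uniq pc) enum_uniq.
have [f1 u1] := cyc_fcycle (c := c1) uc e (mem_head _ _).
have [|f2 u2] := cyc_fcycle (c := c2) uc e; first by rewrite !inE eqxx orbT.
case: sc hm => sz1 sz2 <-; rewrite all_map => hm.
case: c1 sz1 pc e uc f1 u1 => [|a [|b []]] // _ pc e uc f1 u1.
case: c2 sz2 pc e uc f2 u2 => [|c [|d []]] // _ pc e uc f2 u2.
have [ga gb] : g a = b /\ g b = a.
  by move: f1; rewrite /= andbT => /andP[/eqP -> /eqP ->].
have [gc gd] : g c = d /\ g d = c.
  by move: f2; rewrite /= andbT => /andP[/eqP -> /eqP ->].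
have u4 : uniq [:: a; b; c; d].
  have : uniq ([:: a; b; c; d] ++ flatten cs) := uc.
  by rewrite cat_uniq => /and3P[].
exists a, b, c, d; split=> //; apply/permP => u.
rewrite (@pow_part g [:: [:: a; b]; [:: c; d]] cs) //=; first last.
- by rewrite andbT andbb dvdn2; case: (k) ok => //= ?; rewrite negbK.
- by case: (k) ok.
move: u4; rewrite /= !inE !negb_or => /and4P[/and3P[ab ac ad] /andP[bc bd] cd _].
rewrite permM; case: (tpermP a b u) => [->|->|/eqP ua /eqP ub].
- by rewrite eqxx ga tpermD // eq_sym.
- by rewrite eqxx orbT gb tpermD // eq_sym.
rewrite (negbTE ua) (negbTE ub) /=.
by case: tpermP => [->|->|/eqP/negbTE -> /eqP/negbTE ->]; rewrite ?eqxx ?orbT.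
Qed.

End Powers.

(** * Core-free 2-transitive groups *)

Section CoreFree.

Variables (T : finType) (H : {group {perm T}}).
Implicit Types (g h s : {perm T}) (a b c d x y z u v : T).

(** The elements all of whose conjugates lie in [H] form the normal core of [H]. *)
Definition core_free := forall g, (forall s, g ^ s \in H) -> g = 1.

Definition trans2 := forall a b c d, a != b -> c != d ->
  exists2 h, h \in H & h a = c /\ h b = d.

Hypothesis cf : core_free.

Lemma tperm_notin x y : trans2 -> x != y -> tperm x y \notin H.
Proof.
move=> t2 xy; apply/negP => tH; suff /permP/(_ x) : tperm x y = 1.
  by rewrite tpermL perm1 => e; rewrite e eqxx in xy.
apply: cf => s; have sxy : s x != s y by rewrite (inj_eq perm_inj).
have [h hH [hx hy]] := t2 _ _ _ _ xy sxy.
by rewrite tpermJ -hx -hy -tpermJ groupJ.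
Qed.

(** For any [a] and [b], 2-transitivity gives a 3-cycle [(a b c)] in [H], without control over [c].
    Conjugating by some [(c d v)] in [H] replaces [c] by [d], so all 3-cycles lie in [H], against
    core-freeness. *)
Lemma cycle3_notin x y z : trans2 -> uniq [:: x; y; z] -> cycle3 x y z \notin H.
Proof.
move=> t2 u3; apply/negP => cH.
have ex a b : a != b -> exists c, uniq [:: a; b; c] /\ cycle3 a b c \in H.
  move=> ab; have xy : x != y by move: u3; rewrite /= !inE negb_or => /andP[/andP[]].
  have [h hH [<- <-]] := t2 _ _ _ _ xy ab; exists (h z).
  split; last by rewrite -cycle3J groupJ.
  by rewrite -[X in uniq X]/(map h [:: x; y; z]) map_inj_uniq //; apply: perm_inj.
have all3 a b d : uniq [:: a; b; d] -> cycle3 a b d \in H.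
  move=> u; have ab : a != b by move: u; rewrite /= !inE negb_or => /andP[/andP[]].
  have [c [uc ch]] := ex a b ab.
  case: (eqVneq c d) => [<- //|cd]; have [v [uv vh]] := ex c d cd.
  move: (u) (uc) (uv); rewrite /= !inE !negb_or !andbT.
  move=> /andP[/andP[_ ad] bd] /andP[/andP[_ ac] bc] /andP[/andP[_ cv] dv].
  (* If [v] is [a] or [b], the conjugation disturbs that point too; a further product with [(a b c)]
     repairs this, by [cycle3_split]. *)
  case: (eqVneq v a) => [va|va]; [subst v|case: (eqVneq v b) => [vb|vb]; [subst v|]].
  - have -> : cycle3 a b d = (cycle3 a b c ^ cycle3 c d a) * cycle3 a b c.
      rewrite cycle3J !cycle3E // !eqxx (negbTE ac) (negbTE ad) (negbTE bc).
      rewrite (negbTE bd) eq_sym (negbTE ab).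
      by have [] := @cycle3_split T a b c d; rewrite //= !inE ?negb_or ?ab ?ac ?ad ?bc ?bd ?cd.
    by rewrite groupM ?groupJ.
  - have -> : cycle3 a b d = cycle3 a b c * (cycle3 a b c ^ cycle3 c d b).
      rewrite cycle3J !cycle3E // !eqxx (negbTE ac) (negbTE ad) (negbTE bc).
      rewrite (negbTE bd) (negbTE ab).
      by have [] := @cycle3_split T a b c d; rewrite //= !inE ?negb_or ?ab ?ac ?ad ?bc ?bd ?cd.
    by rewrite groupM ?groupJ.
  have -> : cycle3 a b d = cycle3 a b c ^ cycle3 c d v; last by rewrite groupJ.
  rewrite cycle3J !cycle3E // !eqxx (negbTE ac) (negbTE ad) (negbTE bc).
  by rewrite (negbTE bd) !(eq_sym _ v) (negbTE va) (negbTE vb).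
suff /permP/(_ x) : cycle3 x y z = 1.
  rewrite cycle3E // eqxx perm1 => e.
  by move: u3; rewrite e /= inE eqxx.
apply: cf => s; rewrite cycle3J; apply: all3.
by rewrite -[X in uniq X]/(map s [:: x; y; z]) map_inj_uniq //; apply: perm_inj.
Qed.

End CoreFree.

(** * Excluding products of two disjoint transpositions *)

Section CoreFree.

Variables (T : finType) (H : {group {perm T}}).
Implicit Types (g h s : {perm T}) (a b c d x y z u v : T).

Lemma tperm_commute x y s : s x = x -> s y = y -> commute (tperm x y) s.
Proof. by move=> sx sy; apply/commgP/conjg_fixP; rewrite tpermJ sx sy. Qed.

Lemma cycle3_sq x y z : uniq [:: x; y; z] -> cycle3 x y z ^+ 2 = cycle3 x z y.
Proof.
move=> u3; move: (u3); rewrite /= !inE !negb_or andbT.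
case/andP=> /andP[xy xz] yz.
have u3' : uniq [:: x; z; y] by rewrite /= !inE negb_or xz xy eq_sym yz.
apply/permP => w; rewrite expgS expg1 permM !cycle3E //.
have D := (eqxx, negbTE xy, negbTE xz, negbTE yz, eq_sym y x, eq_sym z x,
  eq_sym z y).
have [?|wx] := eqVneq w x; first by subst w; rewrite !D.
have [?|wy] := eqVneq w y; first by subst w; rewrite !D.
have [?|wz] := eqVneq w z; first by subst w; rewrite !D.
by rewrite (negbTE wx) (negbTE wy) (negbTE wz).
Qed.

(** The two quadruples share only [a]. The transpositions [(c d)] and [(c' d')] commute with the
    other factors and vanish on squaring, which leaves the square of a 3-cycle. *)
Lemma sq_tperm2 a b c d b' c' d' : uniq [:: a; b; c; d; b'; c'; d'] ->
  (tperm a b * tperm c d * (tperm a b' * tperm c' d')) ^+ 2 = cycle3 a b' b.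
Proof.
rewrite /= !inE !negb_or => /and4P[/and3P[ab ac /and4P[ad ab' ac' ad']]].
case/and3P=> bc bd /and3P[bb' bc' bd'] /and4P[cd cb' cc' cd'].
case/and4P=> /and3P[db' dc' dd'] /andP[bc2 bd2] cd2 _.
have c1 : commute (tperm c d) (tperm a b') by apply: tperm_commute; apply: tpermD; rewrite // eq_sym.
have c2 : commute (tperm c d) (tperm a b) by apply: tperm_commute; apply: tpermD; rewrite // eq_sym.
have c3 : commute (tperm c' d') (tperm a b') by apply: tperm_commute; apply: tpermD; rewrite // eq_sym.
have c4 : commute (tperm c' d') (tperm a b) by apply: tperm_commute; apply: tpermD; rewrite // eq_sym.
have c5 : commute (tperm c d) (tperm c' d') by apply: tperm_commute; apply: tpermD; rewrite // eq_sym.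
have -> : tperm a b * tperm c d * (tperm a b' * tperm c' d') =
    cycle3 a b b' * (tperm c d * tperm c' d').
  by rewrite /cycle3 !mulgA -(mulgA (tperm a b)) c1 !mulgA.
rewrite expgMn; last by apply: commuteM; apply: commute_sym; apply: commuteM.
have sq (x y : T) : tperm x y ^+ 2 = 1 by rewrite expgS expg1 tperm2.
rewrite (expgMn _ c5) !sq !mulg1.
by apply: cycle3_sq; rewrite /= !inE negb_or ab ab' bb'.
Qed.

(* The fraction of the elements of the stabiliser of [a] mapping [u] to [v] is
   1 / (n - 1), so for n >= 10 some element of this stabiliser moves {b, c, d}
   off itself. *)
Lemma exists_disjoint_translate a b c d : trans2 H -> uniq [:: a; b; c; d] ->
  10 <= #|T| -> exists2 k, k \in H & k a = a /\
    {in [:: b; c; d] &, forall u v, k u != v}.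
Proof.
move=> t2 u4 n10; pose K := [set k in H | k a == a].
pose S := [:: b; c; d].
have aS u : u \in S -> u != a.
  by move=> uS; apply: contraTneq uS => ->; case/andP: u4.
pose A u v := [set k in K | k u == v].
(* Right multiplication by an element of [K] taking [v] to [v'] maps [A u v] injectively into
   [A u v']. *)
have Aeq u v v' : u != a -> v != a -> v' != a -> #|A u v| <= #|A u v'|.
  move=> ua va va'.
  have [k kH [ka kv]] : exists2 k, k \in H & k a = a /\ k v = v'.
    by apply: t2; rewrite // eq_sym.
  rewrite -(card_imset _ (mulIg k)); apply: subset_leq_card.
  apply/subsetP => _ /imsetP[h hA ->]; move: hA.
  rewrite !inE => /andP[/andP[hH /eqP ha] /eqP hu].
  by rewrite groupM // !permM ha ka hu kv !eqxx.
have Acard u v : u != a -> v != a -> (#|T|.-1 * #|A u v|)%N = #|K|.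
  move=> ua va; rewrite -[RHS]sum1_card.
  rewrite (partition_big (fun k : {perm T} => k u) (fun v' : T => v' != a)) /=; last first.
    move=> k; rewrite inE => /andP[_ /eqP ka]; rewrite -[in X in _ != X]ka.
    by rewrite (inj_eq perm_inj).
  rewrite (eq_bigr (fun _ => #|A u v|)); last first.
    move=> v' va'; rewrite sum1dep_card; apply/eqP.
    rewrite -[X in X == _]/(#|[set k in K | k u == v']|) eqn_leq.
    by rewrite !Aeq.
  rewrite sum_nat_const; congr (_ * _)%N.
  by rewrite -(cardC1 a); apply: eq_card => z; rewrite !inE.
case: (pickP (fun k => (k \in K) && all (fun u => all (fun v => k u != v) S) S)).
  move=> k /andP[]; rewrite inE => /andP[kH /eqP ka] /allP kS.
  by exists k => //; split=> // u v uS vS; apply: (allP (kS u uS)).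
move=> none; exfalso.
have e9 : (#|T|.-1 * \sum_(u <- S) \sum_(v <- S) #|A u v|)%N = (9 * #|K|)%N.
  rewrite big_distrr /=; transitivity (\sum_(u <- S) 3 * #|K|)%N.
    apply: eq_big_seq => u uS; rewrite big_distrr /=.
    transitivity (\sum_(v <- S) #|K|)%N.
      by apply: eq_big_seq => v vS; rewrite Acard ?aS.
    by rewrite !big_cons big_nil; move: #|K| => N; lia.
  by rewrite !big_cons big_nil; move: #|K| => N; lia.
have swap : (\sum_(u <- S) \sum_(v <- S) #|A u v|)%N =
    (\sum_(k in K) \sum_(u <- S) \sum_(v <- S) (k u == v))%N.
  rewrite [RHS]exchange_big /=; apply: eq_bigr => u _.
  rewrite [RHS]exchange_big /=; apply: eq_bigr => v _.
  by rewrite -sum1_card big_mkcond [RHS]big_mkcond /=; apply: eq_bigr => k _;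
    rewrite inE; case: (k \in K) => //=; case: eqP.
have K1 : 1 \in K by rewrite inE group1 perm1 eqxx.
(* If every [k] in [K] sends some point of [S] into [S], each contributes at least 1 and the
   identity contributes 3. This excess of 2 contradicts [e9], as [#|T|.-1] is at least 9. *)
have bound : #|K| + 2 <= \sum_(k in K) \sum_(u <- S) \sum_(v <- S) (k u == v).
  rewrite (cardD1 1 K) K1 (bigD1 1) //= addnAC leq_add //.
    by rewrite !big_cons !big_nil !perm1 !eqxx; lia.
  rewrite -sum1_card (eq_bigl (fun k => (k \in K) && (k != 1))); last first.
    by move=> k; rewrite !inE andbC.
  apply: leq_sum => k /andP[kK _]; have := none k; rewrite kK /=.
  by rewrite !big_cons !big_nil; do !case: eqP => _ //=.
have := bound; rewrite -swap; move: e9; set s := (\sum_(u <- S) _)%N.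
nia.
Qed.

(** Multiply the element by its conjugate under a [k] fixing [a] and moving [b], [c], [d] off their
    set: by [sq_tperm2] the square is a 3-cycle of [H]. *)
Lemma tperm2_notin a b c d : core_free H -> trans2 H -> uniq [:: a; b; c; d] ->
  10 <= #|T| -> tperm a b * tperm c d \notin H.
Proof.
move=> cf t2 u4 n10; apply/negP => tH.
have [k kH [ka kS]] := exists_disjoint_translate t2 u4 n10.
have := groupX 2 (groupM tH (groupJ tH kH)).
have u7 : uniq ([:: a; b; c; d] ++ map k [:: b; c; d]).
  have uS : uniq [:: b; c; d] by case/andP: u4.
  have aS : a \notin [:: b; c; d] by case/andP: u4.
  rewrite cat_uniq u4 (map_inj_uniq perm_inj) uS andbT andTb.
  apply/hasPn => _ /mapP[u uS' ->]; apply/negP; rewrite /= inE => /predU1P[e|kuS].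
    by move: aS; rewrite -(@perm_inj _ k u a) ?uS' // e ka.
  by have := kS u (k u) uS' kuS; rewrite eqxx.
rewrite conjMg !tpermJ ka sq_tperm2 //; apply/negP.
apply: cycle3_notin => //; move: u7.
rewrite /= !inE !negb_or => /and4P[/and3P[-> _ /and4P[_ -> _ _]]].
by case/and3P=> _ _ /and3P[]; rewrite eq_sym => ->.
Qed.

End CoreFree.

(** * Fixed points and orbits read off from cycle types *)

Section CycleTypes.

Variable T : finType.
Implicit Types (g h s : {perm T}) (m : seq nat) (x y u v : T).

Lemma has_type_fixfree g m x : has_type g m -> all (leq 2) m -> g x != x.
Proof.
move=> [cs [pc <- e]]; rewrite all_map => /allP m2.
have uc : uniq (flatten cs) by rewrite (perm_uniq pc) enum_uniq.
have : x \in flatten cs by rewrite (perm_mem pc) mem_enum.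
case/flattenP=> c cc xc; have [fc u1] := cyc_fcycle uc e cc.
apply/eqP => gx; have := m2 _ cc; rewrite /= leqNgt => /negP[].
rewrite ltnS -[1%N]/(size [:: x]); apply: uniq_leq_size => // y yc.
have [k <-] := cycle_pow_connect fc xc yc.
by rewrite inE; elim: k => [|k]; rewrite ?expg0 ?perm1 // expgSr permM => /eqP ->; rewrite gx.
Qed.

Lemma has_type_1 g n u v : has_type g [:: n] -> exists k, (g ^+ k) u = v.
Proof.
move=> [cs [pc sc e]]; case: cs sc pc e => [|c [|? ?]] // _ pc e.
have uc : uniq (flatten [:: c]) by rewrite (perm_uniq pc) enum_uniq.
have [fc u1] := cyc_fcycle uc e (mem_head _ _).
by apply: (cycle_pow_connect fc);
  rewrite -[c]cats0 -/(flatten [:: c]) (perm_mem pc) mem_enum.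
Qed.

Lemma has_type_n1 g n : has_type g [:: n; 1%N] ->
  exists2 x, g x = x & forall u v, u != x -> v != x -> exists k, (g ^+ k) u = v.
Proof.
move=> [cs [pc sc e]].
case: cs sc pc e => [|c [|[|x [|? ?]] [|? ?]]] // _ pc e.
have uc : uniq (flatten [:: c; [:: x]]) by rewrite (perm_uniq pc) enum_uniq.
have [fc u1] := cyc_fcycle uc e (mem_head _ _).
have [|fx _] := cyc_fcycle (c := [:: x]) uc e; first by rewrite !inE eqxx orbT.
exists x; first by move: fx; rewrite /= andbT => /eqP.
have mc u : u != x -> u \in c.
  move=> ux; have := mem_enum T u; rewrite -(perm_mem pc) /= mem_cat inE.
  by rewrite (negbTE ux) orbF.
by move=> u v /mc uc' /mc vc; apply: cycle_pow_connect fc uc' vc.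
Qed.

Lemma has_type_n11 g n : has_type g [:: n; 1%N; 1%N] ->
  exists x y, [/\ x != y, g x = x, g y = y & forall u v,
    u \notin [:: x; y] -> v \notin [:: x; y] -> exists k, (g ^+ k) u = v].
Proof.
move=> [cs [pc sc e]].
case: cs sc pc e => [|c [|[|x [|? ?]] [|[|y [|? ?]] [|? ?]]]] // _ pc e.
have uc : uniq (flatten [:: c; [:: x]; [:: y]]).
  by rewrite (perm_uniq pc) enum_uniq.
have [fc u1] := cyc_fcycle uc e (mem_head _ _).
have [|fx _] := cyc_fcycle (c := [:: x]) uc e; first by rewrite !inE eqxx orbT.
have [|fy _] := cyc_fcycle (c := [:: y]) uc e; first by rewrite !inE eqxx !orbT.
exists x, y; split.
- by move: uc; rewrite /= cat_uniq => /and3P[_ _ /=]; rewrite inE => /andP[].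
- by move: fx; rewrite /= andbT => /eqP.
- by move: fy; rewrite /= andbT => /eqP.
have mc u : u \notin [:: x; y] -> u \in c.
  move=> ux; have := mem_enum T u; rewrite -(perm_mem pc) /= mem_cat.
  by rewrite (negbTE ux) orbF.
by move=> u v /mc uc' /mc vc; apply: cycle_pow_connect fc uc' vc.
Qed.

Lemma has_type_unique_fix g m : has_type g (1%N :: m) -> all (leq 2) m ->
  exists2 x, g x = x & forall u, g u = u -> u = x.
Proof.
move=> [cs [pc sc e]] m2.
case: cs sc pc e => [|[|x [|? ?]] cs] // [sc] pc e.
have uc : uniq (flatten ([:: x] :: cs)) by rewrite (perm_uniq pc) enum_uniq.
have [fx _] := cyc_fcycle uc e (mem_head _ _).
exists x; first by move: fx; rewrite /= andbT => /eqP.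
move=> u gu; apply/eqP; apply/negPn/negP => ux.
have := mem_enum T u; rewrite -(perm_mem pc) /= inE (negbTE ux) /=.
case/flattenP=> c cc xc; have [|fc u1] := cyc_fcycle (c := c) uc e.
  by rewrite inE cc orbT.
move: m2; rewrite -sc all_map => /allP/(_ _ cc); rewrite /= leqNgt => /negP[].
rewrite ltnS -[1%N]/(size [:: u]); apply: uniq_leq_size => // y yc.
have [k <-] := cycle_pow_connect fc xc yc.
by rewrite inE; elim: k => [|k]; rewrite ?expg0 ?perm1 // expgSr permM => /eqP ->; rewrite gu.
Qed.

(** The number of points fixed by a 2-group is congruent to [#|T|] modulo 2, and here it is 0. *)
Lemma involution_even (f : T -> T) : involutive f -> (forall x, f x != x) ->
  ~~ odd #|T|.
Proof.
move=> fK fx; pose p := perm (inv_inj fK).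
have p2 : p ^+ 2 = 1 by apply/permP => x; rewrite permX perm1 /= !permE fK.
have pp : 2.-group <[p]> by apply: (@pnat_dvd _ (2 ^ 1)); rewrite ?pnatX // order_dvdn p2.
have acts : [acts <[p]>, on [set: T] | 'P].
  by apply/actsP => g _ x; rewrite !inE.
have := pgroup_fix_mod pp acts.
have -> : 'Fix_([set: T] | 'P)(<[p]>) = set0.
  apply/setP => x; rewrite !inE; apply/negP => /subsetP/(_ p (cycle_id p)).
  by rewrite !inE /= /aperm permE (negbTE (fx x)).
by rewrite cards0 cardsT => /eqP; rewrite mod0n -/(2 %| _) dvdn2.
Qed.

End CycleTypes.

(** * Transitivity and blocks *)

Section Transitive.

Variables (T : finType) (H : {group {perm T}}).
Implicit Types (g h s : {perm T}) (m : seq nat) (a b c d x y u v : T).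

Definition trans1 := forall x y, exists2 h, h \in H & h x = y.

Lemma trans2I x : trans1 -> (forall u v, u != x -> v != x ->
  exists2 h, h \in H & h x = x /\ h u = v) -> trans2 H.
Proof.
move=> t1 tx a b c d ab cd.
have [h1 h1H h1a] := t1 a x; have [h2 h2H h2c] := t1 c x.
have [||k kH [kx kb]] := tx (h1 b) (h2 d).
- by rewrite -h1a (inj_eq perm_inj) eq_sym.
- by rewrite -h2c (inj_eq perm_inj) eq_sym.
exists (h1 * k * h2^-1); first by rewrite !groupM ?groupV.
by rewrite !permM h1a kx kb -{1}h2c !permK.
Qed.

Lemma trans1_n g n : has_type g [:: n] -> g \in H -> trans1.
Proof.
move=> tg gH x y; have [k <-] := has_type_1 x y tg.
by exists (g ^+ k); rewrite ?groupX.
Qed.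

(** [g] is transitive off its fixed point [x], which [g'] moves; hence every point can be brought to
    [g' x]. *)
Lemma trans1_n1 g g' n m : has_type g [:: n; 1%N] -> g \in H ->
  has_type g' m -> all (leq 2) m -> g' \in H -> trans1.
Proof.
move=> /has_type_n1[x gx gt] gH tg' m2 g'H.
have g'x := has_type_fixfree x tg' m2.
have to_x u : exists2 h, h \in H & h u = g' x.
  case: (eqVneq u x) => [->|ux]; first by exists g'.
  have [k <-] := gt u _ ux g'x; by exists (g ^+ k); rewrite ?groupX.
move=> u v; have [h1 h1H h1u] := to_x u; have [h2 h2H h2v] := to_x v.
by exists (h1 * h2^-1); rewrite ?groupM ?groupV // permM h1u -h2v permK.
Qed.

Lemma trans2_n1 g n : trans1 -> has_type g [:: n; 1%N] -> g \in H -> trans2 H.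
Proof.
move=> t1 /has_type_n1[x gx gt] gH; apply: (trans2I (x := x)) => // u v ux vx.
have [k gk] := gt u v ux vx; exists (g ^+ k); rewrite ?groupX //; split=> //.
by elim: (k) => [|j IH]; rewrite ?expg0 ?perm1 // expgSr permM IH.
Qed.

(* The second alternative says that {x, y} is a block of imprimitivity. *)
Lemma trans2_or_block g n : trans1 -> has_type g [:: n; 1%N; 1%N] -> g \in H ->
  trans2 H \/ exists x y, [/\ x != y, g x = x, g y = y,
    forall u v, u \notin [:: x; y] -> v \notin [:: x; y] -> exists k, (g ^+ k) u = v
    & forall h, h \in H -> h x = x -> h y = y].
Proof.
move=> t1 /has_type_n11[x [y [xy gx gy gt]]] gH.
case: (pickP (fun h => [&& h \in H, h x == x & h y != y])); last first.
  move=> none; right; exists x, y; split=> // h hH hx; apply/eqP.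
  by have := none h; rewrite hH hx eqxx /= => /negbFE.
move=> h /and3P[hH /eqP hx hy]; left; apply: (trans2I (x := x)) => //.
have gkx k : (g ^+ k) x = x.
  by elim: k => [|j IH]; rewrite ?expg0 ?perm1 // expgSr permM IH.
have hyx : h y != x by rewrite -hx (inj_eq perm_inj) eq_sym.
(* Since [h] fixes [x] and moves [y], the stabiliser of [x] joins [y] to the orbit of [g] outside
   [{x, y}]. *)
have to_y u : u != x -> exists2 k, k \in H & k x = x /\ k u = h y.
  move=> ux; case: (eqVneq u y) => [->|uy]; first by exists h.
  have [||k gk] := gt u (h y); try by rewrite !inE negb_or ?ux ?hyx.
  by exists (g ^+ k); rewrite ?groupX.
move=> u v /to_y[k1 k1H [k1x k1u]] /to_y[k2 k2H [k2x k2v]].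
exists (k1 * k2^-1); rewrite ?groupM ?groupV // !permM k1x k1u.
by rewrite -k2v -{1}k2x !permK.
Qed.

Lemma uniq_full (r : seq T) : uniq r -> size r = #|T| -> forall z, z \in r.
Proof.
move=> ur sr z; apply/negPn/negP => nz.
have uz : uniq (z :: r) by rewrite cons_uniq nz.
have := uniq_leq_size uz (s2 := enum T).
rewrite -cardE -sr ltnn => h; suff : false by [].
by apply: h => w _; rewrite mem_enum.
Qed.

(** * Transitive groups with blocks of size 2 *)

Section Block.

Variables (g : {perm T}) (x y : T).
Hypotheses (t1 : trans1) (gH : g \in H) (xy : x != y) (gx : g x = x)
  (gy : g y = y).
Hypothesis gt : forall u v, u \notin [:: x; y] -> v \notin [:: x; y] ->
  exists k, (g ^+ k) u = v.
Hypothesis block : forall h, h \in H -> h x = x -> h y = y.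

(** Fixed points of elements of [H] come in blocks: after conjugation by [k], [block] shows that an
    element fixing [k x] also fixes [k y]. *)
Lemma block_unique_fix h m : has_type h (1%N :: m) -> all (leq 2) m ->
  h \notin H.
Proof.
move=> th m2; apply/negP => hH; have [a ha fa] := has_type_unique_fix th m2.
have [k kH kx] := t1 x a.
have e : (k * h * k^-1) x = x by rewrite !permM kx ha -kx permK.
have := block _ e; rewrite !groupM ?groupV // => /(_ isT).
rewrite !permM => /(canRL (permKV k)) /fa ky.
by move: xy; rewrite -(inj_eq (@perm_inj _ k)) kx ky eqxx.
Qed.

Lemma g_unique_fix u : 4 <= #|T| -> g u = u -> u \in [:: x; y].
Proof.
move=> n4 gu; apply/negPn/negP => uxy.
have sub : {subset T <= [:: x; y; u]}.
  move=> v _; case: (boolP (v \in [:: x; y])) => [|vxy].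
    by rewrite !inE => /orP[] ->; rewrite ?orbT.
  have [k <-] := gt uxy vxy.
  have -> : (g ^+ k) u = u.
    by elim: k => [|j IH]; rewrite ?expg0 ?perm1 // expgSr permM IH.
  by rewrite !inE eqxx !orbT.
have := uniq_leq_size (enum_uniq T) (s2 := [:: x; y; u]).
rewrite -cardE => /(_ _)/= h; suff : #|T| <= 3 by rewrite leqNgt n4.
by apply: h => v _; apply: sub.
Qed.

(** The map [f] sends a point to its partner in its block. It is well defined by [block], commutes
    with [H] and has no fixed point. As [g] fixes [f y], this point is [x], so [f] is an
    involution. *)
Lemma block_even : 4 <= #|T| -> ~~ odd #|T|.
Proof.
move=> n4.
have ex a : exists k, (k \in H) && (k x == a).
  by have [k kH <-] := t1 x a; exists k; rewrite kH eqxx.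
pose k a := xchoose (ex a); pose f a := k a y.
have fE h : h \in H -> f (h x) = h y.
  move=> hH; have /andP[kH /eqP kx] := xchooseP (ex (h x)).
  rewrite /f -/(k _) in kH kx *.
  have e : (k (h x) * h^-1) x = x by rewrite permM kx permK.
  have := block _ e; rewrite groupM ?groupV // permM => /(_ isT).
  by move/(canRL (permKV h)).
have feq h a : h \in H -> f (h a) = h (f a).
  move=> hH; have [h' h'H <-] := t1 x a.
  by rewrite fE // -!permM fE // groupM.
have f1 : f x = y by rewrite -[x](perm1 x) fE ?group1 // perm1.
have fa a : f a != a.
  have [h hH <-] := t1 x a; rewrite fE // (inj_eq perm_inj) eq_sym.
  exact: xy.
have fy : f y = x.
  have := g_unique_fix n4 (u := f y); rewrite -feq // gy => /(_ erefl).
  by rewrite !inE (negbTE (fa y)) orbF => /eqP.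
apply: (@involution_even _ f) => // a.
by have [h hH <-] := t1 x a; rewrite fE // feq // fy.
Qed.

(** Conjugate the 3-cycle so that it passes through [y]. If it misses [x], it fixes [x] and moves
    [y]. Otherwise it or its inverse is a [k] taking [x] to [y] and [y] to some [d] outside the
    block; then [k g k^-1] fixes [x], hence [y], so [g] fixes [d]. *)
Lemma block_cycle3 a b c : 4 <= #|T| -> uniq [:: a; b; c] ->
  cycle3 a b c \notin H.
Proof.
move=> n4 u3; apply/negP => cH.
have [k [d [kH kx ky dxy]]] : exists k d,
    [/\ k \in H, k x = y, k y = d & d \notin [:: x; y]].
  have [h hH ha] := t1 a y.
  have := groupJ cH hH; rewrite cycle3J ha.
  have : uniq (map h [:: a; b; c]) by rewrite (map_inj_uniq perm_inj).
  rewrite [map _ _]/= ha; move: (h b) (h c) => b' c' u3' kH.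
  have yx := xy; rewrite eq_sym in yx.
  have := u3'; rewrite /= !inE negb_or andbT => /andP[/andP[yb yc] bc].
  have u3'' : uniq [:: y; c'; b'] by rewrite /= !inE negb_or yc yb eq_sym bc.
  case: (eqVneq x b') => [eb|xb]; last case: (eqVneq x c') => [ec|xc].
  - subst b'; exists (cycle3 y c' x), c'.
    rewrite -(cycle3V u3') groupV cycle3V // !cycle3E // !eqxx (negbTE xy) (negbTE bc).
    by rewrite !inE negb_or eq_sym bc eq_sym yc.
  - subst c'; exists (cycle3 y b' x), b'.
    rewrite !cycle3E // !eqxx (negbTE xy) eq_sym (negbTE bc).
    by rewrite !inE negb_or bc eq_sym yb.
  have := block kH; rewrite !cycle3E // (negbTE xy) (negbTE xb) (negbTE xc) eqxx.
  by move=> /(_ erefl) e; rewrite e eqxx in yb.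
have gd : g d = d.
  have e : (k * g * k^-1) x = x by rewrite !permM kx gy -kx permK.
  have := block _ e; rewrite !groupM ?groupV // => /(_ isT).
  by rewrite !permM ky => /(canRL (permKV k)); rewrite ky.
by have := g_unique_fix n4 gd; rewrite (negbTE dxy).
Qed.

(** An element [h] of [H] with [h x = u] must send [y] to [v] and [{u, v}] to [{x, y}]; then [s] is
    [h] or its product with [(x y)]. *)
Lemma block_swap u v s : #|T| = 4%N -> uniq [:: x; y; u; v] ->
  tperm x y \in H -> s x = u -> s u = x -> s y = v -> s v = y -> s \in H.
Proof.
move=> n4 u4 tH sx su sy sv.
have all4 := uniq_full u4 (esym n4).
have ext g' : g' x = u -> g' y = v -> g' u = x -> g' v = y -> g' = s.
  move=> e1 e2 e3 e4; apply/permP => z; have := all4 z.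
  by rewrite !inE => /or4P[] /eqP ->; rewrite ?sx ?sy ?su ?sv.
move: u4; rewrite /= !inE !negb_or andbT.
case/and3P=> /and3P[_ xu xv] /andP[yu yv] uv.
have [h hH hx] := t1 x u.
have tuy : tperm u y \notin H.
  apply/negP => /block; rewrite tpermD // 1?eq_sym // => /(_ erefl).
  by rewrite tpermR => e; rewrite e eqxx in yu.
have hyH : tperm u (h y) \in H by rewrite -hx -tpermJ groupJ.
have hy : h y = v.
  have := all4 (h y); rewrite !inE => /or4P[] /eqP // e.
  - case/negP: tuy; have := groupJ hyH tH.
    by rewrite e tpermJ tpermL tpermD // eq_sym.
  - by case/negP: tuy; move: hyH; rewrite e.
  - by move: xy; rewrite -(inj_eq (@perm_inj _ h)) hx e eqxx.
have nxy z : z \in [:: u; v] -> h z \in [:: x; y].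
  move=> zuv; have := all4 (h z); rewrite !inE orbA => /orP[//|].
  rewrite -hx -hy !(inj_eq perm_inj) => /orP[] /eqP e; move: zuv.
    by rewrite e !inE (negbTE xu) (negbTE xv).
  by rewrite e !inE (negbTE yu) (negbTE yv).
have huv : h u != h v by rewrite (inj_eq perm_inj).
have := nxy u; have := nxy v; rewrite !inE !eqxx orbT /=.
move=> /(_ isT)/orP[] /eqP hv /(_ isT)/orP[] /eqP hu;
  try by rewrite hu hv eqxx in huv.
- have <- : h * tperm x y = s; last by rewrite groupM.
  apply: ext; rewrite permM.
  + by rewrite hx tpermD.
  + by rewrite hy tpermD.
  + by rewrite hu tpermR.
  by rewrite hv tpermL.
- by have <- : h = s by apply: ext.
Qed.

(** Here [g] is a transposition [(u v)], and a conjugate of it is [(x y)]. So [H] contains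
    [(x y)(u v)] and, by [block_swap], the other two products of this form: the Klein four-group
    lies in the core. *)
Lemma block_not_core_free : #|T| = 4%N -> has_type g [:: 2; 1%N; 1%N] ->
  ~ core_free H.
Proof.
move=> n4 tg cf.
have [||u [v [uv]]] := @pow_tperm T g [:: 1%N; 1%N] 1 tg; try by [].
rewrite expg1 => eg.
have gu : g u = v by rewrite eg tpermL.
have gv : g v = u by rewrite eg tpermR.
have ne z z' : g z = z -> g z' != z' -> z != z'.
  by move=> e; apply: contraNneq => <-; rewrite e.
have gu' : g u != u by rewrite gu eq_sym.
have gv' : g v != v by rewrite gv.
have u4 : uniq [:: x; y; u; v].
  have uv' : u != v by [].
  rewrite /= !inE !negb_or xy uv' (ne x u gx gu') (ne x v gx gv').
  by rewrite (ne y u gy gu') (ne y v gy gv').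
have [h hH hu] := t1 u y.
have tyH : tperm y (h v) \in H by rewrite -hu -tpermJ -eg groupJ.
have hv : x = h v.
  apply/eqP; apply/negPn/negP => nx; have := block tyH.
  rewrite tpermD //; last by rewrite eq_sym.
    rewrite tpermL => /(_ erefl) e; move: uv.
    by rewrite -(inj_eq (@perm_inj _ h)) hu e eqxx.
  by rewrite eq_sym.
have txH : tperm x y \in H by rewrite tpermC hv.
pose k := tperm x y * tperm u v.
have kH : k \in H by rewrite groupM // -eg.
have := u4; rewrite /= !inE !negb_or andbT.
case/and3P=> /and3P[_ xu xv] /andP[yu yv] _.
have all4 := uniq_full u4 (esym n4).
have [kx ky ku kv] : [/\ k x = y, k y = x, k u = v & k v = u].
  by rewrite /k !permM tpermL tpermR -eg gx gy tpermD // tpermD // gu gv.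
have kk z : k (k z) = z /\ k z != z.
  have := all4 z; rewrite !inE => /or4P[] /eqP ->;
    rewrite ?kx ?ky ?ku ?kv; split; rewrite // eq_sym //.
suff /permP/(_ x) : k = 1.
  by rewrite kx perm1 => e; move: xy; rewrite e eqxx.
apply: cf => s; set r := k ^ s.
have rr z : r (r z) = z /\ r z != z.
  rewrite -[z](permKV s) /r !permJ (inj_eq perm_inj).
  by case: (kk (s^-1 z)) => -> ->.
have rC z z' : r z = z' -> r z' = z by move=> <-; case: (rr z).
have swap u' v' : uniq [:: x; y; u'; v'] -> r x = u' -> r \in H.
  move=> u4' rx; have ry : r y = v'.
    have := uniq_full u4' (esym n4) (r y); rewrite !inE => /or4P[] /eqP // ry.
    - by move: u4'; rewrite -rx (rC _ _ ry) /= !inE !eqxx /= andbF.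
    - by have := (rr y).2; rewrite ry eqxx.
    by move: xy; rewrite -(inj_eq (@perm_inj _ r)) rx ry eqxx.
  exact: (block_swap n4 u4' txH rx (rC _ _ rx) ry (rC _ _ ry)).
have := all4 (r x); rewrite !inE => /or4P[] /eqP rx.
- by have := (rr x).2; rewrite rx eqxx.
- suff -> : r = k by [].
  have ru : r u = v.
    have := all4 (r u); rewrite !inE => /or4P[] /eqP // ru.
    + by move: yu; rewrite -rx (rC _ _ ru) eqxx.
    + by move: xu; rewrite -{1}(rC _ _ rx) (rC _ _ ru) eqxx.
    by have := (rr u).2; rewrite ru eqxx.
  apply/permP => z; have := all4 z; rewrite !inE => /or4P[] /eqP ->.
  + by rewrite rx kx.
  + by rewrite ky (rC _ _ rx).
  + by rewrite ru ku.
  by rewrite kv (rC _ _ ru).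
- exact: swap u4 rx.
apply: (swap v u) => //.
by rewrite /= !inE !negb_or xy xu xv yu yv eq_sym uv.
Qed.

End Block.

End Transitive.

(** * Choice of the classes *)

Section ExistsClasses.

Variables (T : finType) (H : {group {perm T}}).
Implicit Types (g h s : {perm T}) (m mu nu : seq nat).

Definition avoids m := forall g, has_type g m -> g \notin H.

(** [nu] is the type of the class [C] and [mu] that of [D]. *)
Definition covering_pair n :=
  exists mu nu, [/\ sumn mu = n /\ sumn nu = n, parity_cover n nu nu false,
    parity_cover n mu nu true, avoids mu & avoids nu].

Lemma meets_or_avoids m : sumn m = #|T| ->
  (exists2 g, g \in H & has_type g m) \/ avoids m.
Proof.
move=> /has_type_exists[g tg].
case: (pickP (fun s => g ^ s \in H)) => [s gs | none].
  by left; exists (g ^ s) => //; apply: has_type_conj.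
right=> h th; have [s ->] := has_type_conjugate tg th.
by rewrite none.
Qed.

Lemma avoids_perm m m' : perm_eq m m' -> avoids m -> avoids m'.
Proof.
by move=> p av g tg; apply: av; apply: has_type_perm tg; rewrite perm_sym.
Qed.

Hypothesis cf : core_free H.

Lemma avoids_2 m k : trans2 H -> all (dvdn^~ k) m -> odd k -> avoids (2 :: m).
Proof.
move=> t2 dm ok g tg; have [x [y [xy e]]] := pow_tperm tg dm ok.
by apply: contra (tperm_notin cf t2 xy) => gH; rewrite -e groupX.
Qed.

Lemma avoids_3 m k : trans2 H -> all (dvdn^~ k) m -> k %% 3 = 1%N ->
  avoids (3 :: m).
Proof.
move=> t2 dm ok g tg; have [x [y [z [u3 e]]]] := pow_cycle3 tg dm ok.
by apply: contra (cycle3_notin cf t2 u3) => gH; rewrite -e groupX.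
Qed.

Lemma avoids_22 m k : trans2 H -> 10 <= #|T| -> all (dvdn^~ k) m -> odd k ->
  avoids [:: 2, 2 & m].
Proof.
move=> t2 n10 dm ok g tg.
have [a [b [c [d [u4 e]]]]] := pow_tperm2 tg dm ok.
by apply: contra (tperm2_notin cf t2 u4 n10) => gH; rewrite -e groupX.
Qed.

Lemma covering_pair_trans2 n : #|T| = n -> trans2 H -> 5 <= n ->
  covering_pair n.
Proof.
move=> Tn t2 n5; have av22 := avoids_22 t2; rewrite Tn {Tn} in av22.
case: (boolP (odd n)) => on.
  suff [mu [s1 s2 s3]] : exists mu, [/\ sumn mu = n,
      parity_cover n mu [:: n - 2; 2] true & avoids mu].
    exists mu, [:: n - 2; 2]; split=> //; first by split=> //=; lia.
      exact: cover_n2_even.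
    apply: (@avoids_perm [:: 2; n - 2]); first exact: (permEl (perm_catC [:: _] [:: _])).
    by apply: (avoids_2 (k := n - 2)) => //=; rewrite ?dvdnn // oddB ?on //; lia.
  (* Up to 9 points the chosen type has a 3-cycle as its power of exponent 1, 4 and 4 respectively;
     from 11 on, the odd power [n - 4] is a product of two transpositions. *)
  have : [\/ n = 5, n = 7, n = 9 | 11 <= n].
    have : n = 5 \/ n = 7 \/ n = 9 \/ 11 <= n by lia.
    by case=> [->|[->|[->|->]]]; [constructor 1 | constructor 2 | constructor 3
      | constructor 4].
  case=> [en|en|en|n11]; try subst n.
  - exists [:: 3; 1%N; 1%N]; split=> //; first exact: cover_5_311.
    exact: (avoids_3 (k := 1)).
  - exists [:: 3; 2; 2]; split=> //; first exact: cover_n2_odd.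
    exact: (avoids_3 (k := 4)).
  - exists [:: 4; 3; 2]; split=> //; first exact: cover_9_342.
    by apply: (@avoids_perm [:: 3; 4; 2]) => //; apply: (avoids_3 (k := 4)).
  exists [:: n - 4; 2; 2]; split=> /=; [lia | by apply: cover_n2_odd => //; lia |].
  apply: (@avoids_perm [:: 2; 2; n - 4]).
    exact: (permEl (perm_catC [:: _; _] [:: _])).
  by apply: (av22 _ (n - 4)) => //=; rewrite ?dvdnn //; lia.
suff [mu [s1 s2 s3]] : exists mu, [/\ sumn mu = n,
    parity_cover n mu [:: n - 3; 2; 1%N] true & avoids mu].
  exists mu, [:: n - 3; 2; 1%N]; split=> //; first by split=> //=; lia.
    by apply: cover_n3_even => //; lia.
  apply: (@avoids_perm [:: 2; n - 3; 1%N]).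
    exact: (permEl (perm_catCA [:: _] [:: _] _)).
  by apply: (avoids_2 (k := n - 3)) => //=; rewrite ?dvdnn ?dvd1n //; lia.
have : [\/ n = 6, n = 8 | 10 <= n].
  have : n = 6 \/ n = 8 \/ 10 <= n by lia.
  by case=> [->|[->|->]]; [constructor 1 | constructor 2 | constructor 3].
case=> [en|en|n10]; try subst n.
- exists [:: 3; 1%N; 1%N; 1%N]; split=> //; first exact: cover_6_3111.
  exact: (avoids_3 (k := 1)).
- exists [:: 3; 2; 2; 1%N]; split=> //; first exact: cover_n3_odd.
  exact: (avoids_3 (k := 4)).
exists [:: n - 5; 2; 2; 1%N]; split=> /=; [lia | by apply: cover_n3_odd => //; lia |].
apply: (@avoids_perm [:: 2; 2; n - 5; 1%N]).
  exact: (permEl (perm_catCA [:: _; _] [:: _] _)).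
by apply: (av22 _ (n - 5)) => //=; rewrite ?dvdnn ?dvd1n //; lia.
Qed.

(** From [n = 8] on, both types have exactly one fixed point, which the blocks forbid. For [n = 6]
    the type [(n - 5, 2, 2, 1)] would have two, so a 3-cycle is used there instead. *)
Lemma covering_pair_block g n :
  #|T| = n -> 4 <= n -> trans1 H -> g \in H -> has_type g [:: n - 2; 1%N; 1%N] ->
  (exists x y, [/\ x != y, g x = x, g y = y,
    forall u v, u \notin [:: x; y] -> v \notin [:: x; y] -> exists k, (g ^+ k) u = v
    & forall h, h \in H -> h x = x -> h y = y]) ->
  covering_pair n.
Proof.
move=> Tn n4 t1 gH tg [x [y [xy gx gy gt bl]]].
have n4' : 4 <= #|T| by rewrite Tn.
have en : ~~ odd n by rewrite -Tn; apply: (block_even t1 gH xy gy gt bl).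
have : [\/ n = 4, n = 6 | 8 <= n].
  have : n = 4 \/ n = 6 \/ 8 <= n by lia.
  by case=> [->|[->|->]]; [constructor 1 | constructor 2 | constructor 3].
case=> [e|e|n8].
- rewrite e in tg Tn.
  by case: (block_not_core_free t1 gH xy gx gy bl Tn tg cf).
- exists [:: 3; 1%N; 1%N; 1%N], [:: 3; 2; 1%N]; rewrite e; split=> //.
  + exact: cover_n3_even.
  + exact: cover_6_3111.
  + move=> h /(@pow_cycle3 _ _ _ 1)[] // a [b [c [u3]]]; rewrite expg1 => ->.
    exact: (block_cycle3 t1 gH xy gy gt bl).
  apply: (@avoids_perm [:: 1%N; 3; 2]) => // h th.
  by apply: (block_unique_fix t1 xy bl th).
exists [:: n - 5; 2; 2; 1%N], [:: n - 3; 2; 1%N]; split.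
- by split=> /=; lia.
- by apply: cover_n3_even => //; lia.
- exact: cover_n3_odd.
- apply: (@avoids_perm [:: 1%N; n - 5; 2; 2]).
    exact: (permEl (perm_catC [:: _] [:: _; _; _])).
  by move=> h th; apply: (block_unique_fix t1 xy bl th) => /=; lia.
apply: (@avoids_perm [:: 1%N; n - 3; 2]).
  exact: (permEl (perm_catC [:: _] [:: _; _])).
by move=> h th; apply: (block_unique_fix t1 xy bl th) => /=; lia.
Qed.

Lemma exists_covering_pair n : #|T| = n -> 4 <= n -> covering_pair n.
Proof.
move=> Tn n4.
have dec m : sumn m = n -> (exists2 g, g \in H & has_type g m) \/ avoids m.
  by rewrite -Tn; apply: meets_or_avoids.
have c1e : parity_cover n [:: n] [:: n] false by apply: cover_n_even; lia.
have [|[g1 g1H tg1]|av1] := dec [:: n.-1; 1%N]; first by rewrite /=; lia.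
  (* For [n = 4] the element [g1] is itself a 3-cycle, so the 2-transitive case cannot occur. *)
  have small2 : trans2 H -> covering_pair n.
    move=> t2; have [e|n5] : n = 4 \/ 5 <= n by lia.
      rewrite e in tg1.
      have := @avoids_3 [:: 1%N] 1 t2 isT erefl g1 tg1.
      by rewrite g1H.
    exact: covering_pair_trans2 Tn t2 n5.
  have [|[g gH tg]|avn] := dec [:: n]; first by rewrite /=; lia.
    exact/small2/(trans2_n1 (trans1_n tg gH) tg1 g1H).
  have [|[g2 g2H tg2]|av2] := dec [:: n - 2; 2]; first by rewrite /=; lia.
    apply: small2; apply: (trans2_n1 _ tg1 g1H).
    by apply: (trans1_n1 tg1 g1H tg2) => //=; lia.
  exists [:: n - 2; 2], [:: n]; split=> //; first by split=> /=; lia.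
  exact: cover_n_odd2.
have [|[g gH tg]|avn] := dec [:: n]; first by rewrite /=; lia.
  have t1 := trans1_n tg gH.
  have [|[g2 g2H tg2]|av2] := dec [:: n - 2; 1%N; 1%N]; first by rewrite /=; lia.
    have [t2|] := trans2_or_block t1 tg2 g2H; last first.
      exact: covering_pair_block Tn n4 t1 g2H tg2.
    (* For [n = 4] the element [g2] is a transposition, again impossible. *)
    have [e|n5] : n = 4 \/ 5 <= n by lia.
      rewrite e in tg2.
      have := @avoids_2 [:: 1%N; 1%N] 1 t2 isT isT g2 tg2.
      by rewrite g2H.
    exact: covering_pair_trans2 Tn t2 n5.
  exists [:: n - 2; 1%N; 1%N], [:: n.-1; 1%N]; split=> //.
  - by split=> /=; lia.
  - exact: cover_n1_even.
  exact: cover_n1_odd.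
exists [:: n.-1; 1%N], [:: n]; split=> //; first by split=> /=; lia.
by apply: cover_n_odd; lia.
Qed.

End ExistsClasses.

Theorem theorem3p8 (n : nat) (T : finType) (to : {action 'S_n &-> T})
    (w : T) (H : {group 'S_n})
    (n_ge4 : 4 <= n)
    (to_trans : [transitive [set: 'S_n], on [set: T] | to])
    (to_faithful : [faithful [set: 'S_n], on [set: T] | to])
    (H_stab : H :=: 'C[w | to]) :
  [set: 'S_n] = derangements to [set: 'S_n] * derangements to [set: 'S_n]
  /\ (~ is_natural_action to ->
      exists C D : {set 'S_n},
        [/\ derangement_class to [set: 'S_n] C,
            derangement_class to [set: 'S_n] D
          & [set: 'S_n] = C * C :|: C * D]).
Proof.
have memH g : (g \in H) = (to w g == w).
  by rewrite H_stab; apply/astab1P/eqP.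
have orb t : exists s, t = to w s.
  have : t \in orbit to [set: 'S_n] w by rewrite (atransP to_trans) ?inE.
  by case/orbitP=> s _ <-; exists s.
(* The core of a point stabiliser of a transitive action is the kernel of the action. *)
have cf : core_free H.
  move=> g gH; apply: (faithfulP to_faithful); first by rewrite inE.
  move=> t _; have [s ->] := orb t.
  have := gH s^-1; rewrite memH conjgE invgK !actM => /eqP e.
  by rewrite -[in RHS]e actKV.
have [mu [nu [[smu snu] ceven codd amu anu]]] :=
  exists_covering_pair cf (card_ord n) n_ge4.
(* All point stabilisers are conjugate to [H], so an element fixing a point would have a conjugate
   in [H]. *)
have cls m : sumn m = n -> avoids H m -> exists2 C : {set 'S_n},
    derangement_class to [set: 'S_n] C & forall g, has_type g m -> g \in C.
  move=> sm am; have [|g tg] := @has_type_exists 'I_n m; first by rewrite card_ord.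
  exists (g ^: [set: 'S_n]); last first.
    by move=> h th; have [s ->] := has_type_conjugate tg th; rewrite memJ_class ?inE.
  split; first by rewrite mem_classes ?inE.
  apply/subsetP => _ /imsetP[s _ ->]; rewrite !inE /=.
  apply/eqP/setP => t; rewrite !inE; apply/negP; rewrite sub1set inE => /eqP.
  have [r ->] := orb t; rewrite -actM => e.
  have := am _ (has_type_conj r^-1 (has_type_conj s tg)).
  by rewrite memH conjgE invgK mulgA actM e actK eqxx.
have [C dC CE] := cls nu snu anu; have [D dD DE] := cls mu smu amu.
have cover : [set: 'S_n] = C * C :|: C * D.
  apply/eqP; rewrite eqEsubset subsetT andbT; apply/subsetP => g _.
  have [l [tl pl sl _]] := has_type_total g; rewrite card_ord in sl.
  have x0 : 'I_n by apply: (@Ordinal _ 0); lia.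
  (* The identity [g d = c] is read as [g = c d^-1], and [d^-1] has the same type as [d]. *)
  have fact m : Factor l m nu ->
      exists c d, [/\ has_type c nu, has_type d m & g = c * d].
    move=> /(Factor_has_type x0 tl)[c [d [tc td gd]]]; exists c, d^-1.
    by split=> //; [exact: has_type_inv | rewrite -gd mulgK].
  rewrite inE; apply/orP; case e: (odd (n - size l)); [right | left].
    have [c [d [/CE cC /DE dD' ->]]] := fact mu (codd l pl sl e).
    exact: mem_mulg.
  have [c [d [/CE cC /CE dC' ->]]] := fact nu (ceven l pl sl e).
  exact: mem_mulg.
split; last by exists C, D.
(* Both products lie in the square of the set of derangements, since [C] and [D] consist of
   derangements. *)
apply/eqP; rewrite eqEsubset subsetT andbT {1}cover subUset.
by case: dC dD => _ sC [_ sD]; rewrite !mulgSS.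
Qed.
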